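(* Let $f:\mathbb{R}^d\to\mathbb{R}$ be $\ell$-smooth with $\ell>0$, let the stochastic gradient $g(x;\xi)$ be unbiased with variance bounded by $\sigma^2$, and let $f(x_0)-\min_{x\in\mathbb{R}^d}f(x)\le\Delta$. Run AdaGrad-norm, i.e. for $t=0,1,2,\dots$ $$x_{t+1}=x_t-\eta_t\,g(x_t;\xi_t),\qquad \eta_t=\frac{\eta}{\sqrt{v_0^2+\sum_{k=0}^t\|g(x_k;\xi_k)\|^2}}.$$ Then for any $\eta>0$ and $v_0>0$, $$\frac1T\sum_{t=0}^{T-1}\mathbb{E}\|\nabla f(x_t)\|\le\frac{2A}{\sqrt T}+\frac{\sqrt{v_0A}}{\sqrt T}+\frac{2\sqrt{A\sigma}}{T^{1/4}},$$ where $A=\widetilde{O}\left(\frac{\Delta}{\eta}+\sigma+\ell\eta\right)$.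
   Context: A function $f:\mathbb{R}^d\to\mathbb{R}$ is $\ell$-smooth if it is differentiable and $\|\nabla f(x_1)-\nabla f(x_2)\|\le \ell\|x_1-x_2\|$ for all $x_1,x_2\in\mathbb{R}^d$. Stochastic gradient oracle: for every $x\in\mathbb{R}^d$, $\mathbb{E}_\xi[g(x;\xi)]=\nabla f(x)$ and $\mathbb{E}_\xi\|g(x;\xi)-\nabla f(x)\|^2\le\sigma^2$. The samples $\xi_0,\xi_1,\dots$ are drawn afresh at each iteration (independently of the past) from the distribution of $\xi$. The notation $A=\widetilde O(B)$ means that $A$ is bounded by $B$ times an absolute constant times factors at most logarithmic in $T$, the problem parameters ($\ell,\Delta,\sigma$) and the hyper-parameters ($\eta,v_0$). *)

(* Defs.v *)
From HB Require Import structures.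
From mathcomp Require Import all_boot all_order all_algebra.
From mathcomp Require Import all_classical all_reals all_analysis.

Set Implicit Arguments.
Unset Strict Implicit.
Unset Printing Implicit Defensive.

Import Order.TTheory GRing.Theory Num.Theory.
Import numFieldNormedType.Exports.

Local Open Scope classical_set_scope.
Local Open Scope ring_scope.

(* The library norm `|x| on row vectors is the sup norm, so the Euclidean norm
   is defined here. All norms on R^d are equivalent, hence [differentiable] has
   its usual meaning. *)
Definition enorm (R : realType) (d : nat) (x : 'rV[R]_d) : R :=
  Num.sqrt (\sum_(i < d) x 0 i ^+ 2).

Definition grad (R : realType) (d : nat) (f : 'rV[R]_d -> R) (x : 'rV[R]_d) :
  'rV[R]_d := \row_(i < d) 'D_(delta_mx 0 i) f x.

Definition smooth (R : realType) (d : nat) (ell : R) (f : 'rV[R]_d -> R) :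
    Prop :=
  (forall x, differentiable f x) /\
  (forall x1 x2, enorm (grad f x1 - grad f x2) <= ell * enorm (x1 - x2)).

(* [g] is jointly measurable, R^d carrying its Borel sigma-algebra, i.e. the
   product sigma-algebra of the tuple type [d.-tuple R]. *)
Definition jointly_measurable (R : realType) (d : nat) (dX : measure_display)
    (Xi : measurableType dX) (g : 'rV[R]_d -> Xi -> 'rV[R]_d) : Prop :=
  forall j : 'I_d, measurable_fun setT
    (fun p : d.-tuple R * Xi => g (\row_(i < d) tnth p.1 i) p.2 0 j).

(* [D] is the distribution of the sample xi; the expectation of a random vector
   is taken coordinatewise. *)
Definition stochastic_gradient (R : realType) (d : nat) (dX : measure_display)
    (Xi : measurableType dX) (D : probability Xi R) (sigma : R)
    (f : 'rV[R]_d -> R) (g : 'rV[R]_d -> Xi -> 'rV[R]_d) : Prop :=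
  [/\ jointly_measurable g,
      forall x (i : 'I_d), D.-integrable setT (fun z => (g x z 0 i)%:E),
      forall x (i : 'I_d), ('E_D[(fun z => g x z 0 i)%R])%E = (grad f x 0 i)%:E &
      forall x, ('E_D[(fun z => enorm (g x z - grad f x) ^+ 2)%R]
                 <= (sigma ^+ 2)%:E)%E].

Definition mutually_independent (R : realType) (dO dX : measure_display)
    (Omega : measurableType dO) (Xi : measurableType dX)
    (P : probability Omega R) (xi : nat -> Omega -> Xi) : Prop :=
  forall (s : seq nat) (B : nat -> set Xi),
    uniq s -> (forall i, measurable (B i)) ->
    P (\bigcap_(i in [set` s]) (xi i @^-1` B i)) =
    (\prod_(i <- s) P (xi i @^-1` B i))%E.

Definition iid_samples (R : realType) (dO dX : measure_display)
    (Omega : measurableType dO) (Xi : measurableType dX)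
    (P : probability Omega R) (D : probability Xi R)
    (xi : nat -> Omega -> Xi) : Prop :=
  [/\ forall t, measurable_fun setT (xi t),
      forall t (B : set Xi), measurable B -> P (xi t @^-1` B) = D B &
      mutually_independent P xi].

Definition adagrad_stepsize (R : realType) (d : nat) (eta v0 : R)
    (gs : nat -> 'rV[R]_d) (t : nat) : R :=
  eta / Num.sqrt (v0 ^+ 2 + \sum_(k < t.+1) enorm (gs k) ^+ 2).

Definition adagrad_norm (R : realType) (d : nat) (Omega Xi : Type)
    (g : 'rV[R]_d -> Xi -> 'rV[R]_d) (xi : nat -> Omega -> Xi)
    (x0 : 'rV[R]_d) (eta v0 : R) (x : nat -> Omega -> 'rV[R]_d) : Prop :=
  forall w : Omega,
    let gs := fun t => g (x t w) (xi t w) in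
    x 0%N w = x0 /\
    forall t, x t.+1 w = x t w - adagrad_stepsize eta v0 gs t *: gs t.

(* Quantities depending on T, ell, Delta, sigma, eta and v0, in this order. *)
Definition quantity (R : realType) : Type := nat -> R -> R -> R -> R -> R -> R.

(* [Delta] and [sigma] may vanish, whence ln (1 + _) for the problem parameters;
   [eta] and [v0] may be arbitrarily small or large, whence `|ln _|. *)
Definition log_factor (R : realType) : quantity R :=
  fun T ell Delta sigma eta v0 =>
    1 + ln T%:R + ln (1 + ell) + ln (1 + Delta) + ln (1 + sigma)
      + `|ln eta| + `|ln v0|.

Definition tildeO (R : realType) (A B : quantity R) : Prop :=
  exists C : R, forall T ell Delta sigma eta v0,
    (0 < T)%N -> 0 < ell -> 0 <= Delta -> 0 <= sigma -> 0 < eta -> 0 < v0 ->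
    `|A T ell Delta sigma eta v0|
      <= C * log_factor T ell Delta sigma eta v0
           * B T ell Delta sigma eta v0.

(* Main.v *)
(* The difficulty is that the stepsize eta / v, with v ^+ 2 the accumulated squared
   norms, depends on the current sample. It is compared with the predictable
   proxy eta / w obtained by replacing |g| ^+ 2 by |grad f| ^+ 2 + tau ^+ 2; by
   Young's inequality the error is paid for by half of the descent
   |grad f| ^+ 2 / w and by terms |g| ^+ 2 / v ^+ 2, whose sum telescopes into a
   logarithm. Summing the descent inequality along a path bounds
   sum |grad f| ^+ 2 / w, and since w is itself at most of the order of
   v0 + tau sqrt T + sqrt (sum |grad f| ^+ 2), it bounds sqrt (sum |grad f| ^+ 2)
   by a constant plus terms a_t (|xi_t| ^+ 2 - tau ^+ 2) - <H_t, xi_t>, where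
   xi_t is the noise and a_t >= 0 and H_t only depend on the past. The
   expectations of these are nonpositive by Fubini's theorem, because (iterate,
   accumulated norm) is a Markov chain independent of the next sample.

   The proof divides by tau, so it uses tau = sigma + ell eta / T > 0 as the
   noise level in place of sigma, which may vanish. *)

Require Import Defs.
From HB Require Import structures.
From mathcomp Require Import all_boot all_order all_algebra.
From mathcomp Require Import all_classical all_reals all_analysis.
From mathcomp Require Import measurable_realfun ring lra.

Set Implicit Arguments.
Unset Strict Implicit.
Unset Printing Implicit Defensive.

Import Order.TTheory GRing.Theory Num.Theory.
Import numFieldNormedType.Exports.

Local Open Scope classical_set_scope.
Local Open Scope ring_scope.

(** * Euclidean norm and descent inequality *)

Definition dot (R : realType) (d : nat) (x y : 'rV[R]_d) : R :=
  \sum_(i < d) x 0 i * y 0 i.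

Section Euclidean.
Context {R : realType} {d : nat}.
Implicit Types x y z : 'rV[R]_d.

Lemma dotC x y : dot x y = dot y x.
Proof. by apply: eq_bigr => i _; rewrite mulrC. Qed.

Lemma dotDr x y z : dot x (y + z) = dot x y + dot x z.
Proof. by rewrite -big_split/=; apply: eq_bigr => i _; rewrite mxE mulrDr. Qed.

Lemma dotZr a x y : dot x (a *: y) = a * dot x y.
Proof. by rewrite mulr_sumr; apply: eq_bigr => i _; rewrite mxE mulrCA. Qed.

Lemma dotNr x y : dot x (- y) = - dot x y.
Proof. by rewrite -scaleN1r dotZr mulN1r. Qed.

Lemma dotDl x y z : dot (x + y) z = dot x z + dot y z.
Proof. by rewrite dotC dotDr !(dotC z). Qed.

Lemma dotBl x y z : dot (x - y) z = dot x z - dot y z.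
Proof. by rewrite dotDl (dotC (- y)) dotNr (dotC z). Qed.

Lemma dotxx_ge0 x : 0 <= dot x x.
Proof. by apply: sumr_ge0 => i _; rewrite -expr2 sqr_ge0. Qed.

Lemma enorm_ge0 x : 0 <= enorm x.
Proof. exact: sqrtr_ge0. Qed.

Lemma enorm_sqr x : enorm x ^+ 2 = dot x x.
Proof.
rewrite sqr_sqrtr; last by apply: sumr_ge0 => i _; exact: sqr_ge0.
by apply: eq_bigr => i _; rewrite expr2.
Qed.

Lemma enormZ a x : enorm (a *: x) = `|a| * enorm x.
Proof.
apply/eqP; rewrite -(@eqrXn2 _ 2)//; last 2 first.
- exact: enorm_ge0.
- by rewrite mulr_ge0// enorm_ge0.
by rewrite exprMn !enorm_sqr dotZr dotC dotZr mulrA -expr2 real_normK// num_real.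
Qed.

Lemma enormN x : enorm (- x) = enorm x.
Proof. by rewrite -scaleN1r enormZ normrN1 mul1r. Qed.

(** Cauchy-Schwarz, from the nonnegative square of [enorm y *: x - enorm x *: y]. *)
Lemma le_dot_enorm x y : dot x y <= enorm x * enorm y.
Proof.
have [x0|x0] := eqVneq (enorm x) 0.
  suff -> : x = 0 by rewrite /dot big1 ?mulr_ge0 ?enorm_ge0// => i _; rewrite mxE mul0r.
  have /eqP : dot x x = 0 by rewrite -enorm_sqr x0 expr0n.
  rewrite psumr_eq0; last by move=> i _; rewrite -expr2 sqr_ge0.
  move/allP => h; apply/rowP => i; rewrite mxE; apply/eqP.
  by move: (h i); rewrite mem_index_enum mulf_eq0 orbb => /(_ isT).
have [y0|y0] := eqVneq (enorm y) 0.
  suff -> : y = 0 by rewrite /dot big1 ?mulr_ge0 ?enorm_ge0// => i _; rewrite mxE mulr0.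
  have /eqP : dot y y = 0 by rewrite -enorm_sqr y0 expr0n.
  rewrite psumr_eq0; last by move=> i _; rewrite -expr2 sqr_ge0.
  move/allP => h; apply/rowP => i; rewrite mxE; apply/eqP.
  by move: (h i); rewrite mem_index_enum mulf_eq0 orbb => /(_ isT).
have px : 0 < enorm x by rewrite lt_neqAle eq_sym x0 enorm_ge0.
have py : 0 < enorm y by rewrite lt_neqAle eq_sym y0 enorm_ge0.
set v := (enorm y) *: x - (enorm x) *: y.
have := dotxx_ge0 v.
rewrite /v dotDr dotNr !dotZr !dotBl ![dot (_ *: _) _]dotC !dotZr (dotC y x).
rewrite -!enorm_sqr => h.
have : 0 <= 2 * (enorm x * enorm y) * (enorm x * enorm y - dot x y) by lra.
rewrite pmulr_rge0 ?subr_ge0//.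
by rewrite mulr_gt0// mulr_gt0.
Qed.

Lemma abs_dot_le x y : `|dot x y| <= enorm x * enorm y.
Proof.
rewrite ler_norml le_dot_enorm andbT lerNl -dotNr.
by rewrite (le_trans (le_dot_enorm _ _))// enormN.
Qed.

Lemma ler_enormD x y : enorm (x + y) <= enorm x + enorm y.
Proof.
rewrite -(@ler_pXn2r _ 2)// ?nnegrE ?addr_ge0 ?enorm_ge0//.
rewrite enorm_sqr dotDr !dotDl (dotC y x) -!enorm_sqr.
by have := le_dot_enorm x y; lra.
Qed.

Lemma ler_enormB x y : `|enorm x - enorm y| <= enorm (x - y).
Proof.
have h1 := ler_enormD (x - y) y; have h2 := ler_enormD (y - x) x.
rewrite !subrK in h1 h2; rewrite -[enorm (y - x)]enormN opprB in h2.
by rewrite ler_norml; apply/andP; split; lra.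
Qed.

Lemma enormD_sqr_le x y : enorm (x + y) ^+ 2 <= 2 * enorm x ^+ 2 + 2 * enorm y ^+ 2.
Proof.
rewrite enorm_sqr dotDr !dotDl (dotC y x) -!enorm_sqr.
by have := le_dot_enorm x y; have := sqr_ge0 (enorm x - enorm y); lra.
Qed.

End Euclidean.

Section Descent.
Context {R : realType} {d : nat} (f : 'rV[R]_d -> R) (ell : R).
Hypotheses (ell0 : 0 < ell) (fs : smooth ell f).

(** Differentiability makes the directional derivative linear in [v], hence a combination of the
    partial derivatives. *)
Lemma deriveE_grad x v : 'D_v f x = dot (grad f x) v.
Proof.
have df := fs.1 x.
rewrite (deriveE _ df) [in LHS](row_sum_delta v) linear_sum/=.
by apply: eq_bigr => i _; rewrite linearZ/= -(deriveE _ df) mxE mulrC.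
Qed.

Lemma is_derive_line x v (t : R) :
  is_derive t 1 (fun s : R => f (x + s *: v)) (dot (grad f (x + t *: v)) v).
Proof.
rewrite -deriveE_grad.
have E : (fun h : R => h^-1 *: (f (x + (h *: 1 + t) *: v) - f (x + t *: v))) =
  (fun h : R => h^-1 *: (f (h *: v + (x + t *: v)) - f (x + t *: v))).
  apply/funext => h; congr (_ *: (f _ - _)).
  by rewrite scalerDl addrCA -[h *: 1]/(h * 1) mulr1.
split.
  by rewrite /derivable/= E; exact: (diff_derivable (fs.1 _)).
by rewrite /derive/= E.
Qed.

(** The mean value theorem bounds the variation of the gradient at one intermediate point, whence
    [ell] instead of the classical [ell / 2]; only constants are affected. *)
Lemma descent x y :
  f y <= f x + dot (grad f x) (y - x) + ell * enorm (y - x) ^+ 2.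
Proof.
set v := y - x.
have cf : {within `[0, 1], continuous (fun s : R => f (x + s *: v))}.
  apply: continuous_subspaceT => s; apply: differentiable_continuous.
  by apply/derivable1_diffP; have [] := is_derive_line x v s.
have [c + ] := @MVT R _ (fun s => dot (grad f (x + s *: v)) v) 0 1 ltr01
  (fun s _ => is_derive_line x v s) cf.
rewrite in_itv/= => /andP[c0 c1].
rewrite subr0 mulr1 scale1r scale0r addr0 [x + v]addrC subrK => fE.
have -> : f y = f x + dot (grad f x) v + dot (grad f (x + c *: v) - grad f x) v.
  by rewrite dotBl; lra.
rewrite lerD2l (le_trans (le_dot_enorm _ _))//.
rewrite expr2 mulrA ler_wpM2r ?enorm_ge0//.
rewrite (le_trans (fs.2 _ _))// addrC addKr enormZ gtr0_norm// (ler_wpM2l (ltW ell0))//.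
by rewrite ler_piMl ?enorm_ge0// ltW.
Qed.

(** A gradient step with stepsize [(2 * ell)^-1] cannot go below the minimum, and [descent] says how
    much it gains. *)
Lemma enorm_grad_sqr_le x xmin : (forall y, f xmin <= f y) ->
  enorm (grad f x) ^+ 2 <= 4 * ell * (f x - f xmin).
Proof.
move=> fmin; set G := grad f x.
have := descent x (x - (2 * ell)^-1 *: G); have := fmin (x - (2 * ell)^-1 *: G).
have -> : x - (2 * ell)^-1 *: G - x = - ((2 * ell)^-1 *: G).
  by rewrite addrAC subrr add0r.
rewrite -/G dotNr dotZr enormN enormZ exprMn -enorm_sqr.
have l0 : 0 < (2 * ell)^-1 by rewrite invr_gt0 mulr_gt0.
rewrite gtr0_norm// => h1 h2.
have : (2 * ell)^-1 * (1/2) * enorm G ^+ 2 <= f x - f xmin.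
  have e : ell * (2 * ell)^-1 = 2^-1 by field; rewrite gt_eqF.
  have : ell * ((2 * ell)^-1 ^+ 2 * enorm G ^+ 2) =
      (2 * ell)^-1 * 2^-1 * enorm G ^+ 2.
    by rewrite expr2 !mulrA e; ring.
  lra.
have -> : (2 * ell)^-1 * (1/2) * enorm G ^+ 2 = enorm G ^+ 2 / (4 * ell).
  by field; rewrite gt_eqF.
by rewrite ler_pdivrMr ?mulr_gt0// mulrC.
Qed.

End Descent.

(** * Scalar estimates *)

Section ScalarEstimates.
Context {R : realType}.
Implicit Types p q r tau v w e : R.

(* [w] is the stepsize denominator in which the current stochastic gradient
   (norm [q]) is replaced by the predictable proxy [p ^+ 2 + tau ^+ 2]. *)
Lemma decorrelation p q r tau v w e : 0 <= p -> 0 <= q -> 0 < tau ->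
  0 < v -> q <= v -> p <= w -> tau <= w ->
  v ^+ 2 - w ^+ 2 = q ^+ 2 - p ^+ 2 - tau ^+ 2 ->
  `|q - p| <= r -> `|e| <= p * q ->
  e / w - 2 * tau * (q ^+ 2 / v ^+ 2)
    - p ^+ 2 * (r ^+ 2 + tau ^+ 2) / (4 * tau ^+ 2 * w) <= e / v.
Proof.
move=> p0 q0 tau0 v0 qv pw tauw vw rqp epq.
have w0 : 0 < w by apply: lt_le_trans tauw.
have r0 : 0 <= r by apply: le_trans rqp.
have vw0 : 0 < v * w by rewrite mulr_gt0.
(* Multiplied by [v + w], the difference [w - v] becomes [p ^+ 2 - q ^+ 2 + tau ^+ 2], and [v + w]
   dominates both [q + p] and [tau]. *)
have dvw : `|w - v| <= r + tau.
  have s0 : 0 < v + w by rewrite addr_gt0.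
  rewrite -(ler_pM2r s0) -{1}(gtr0_norm s0) -normrM.
  have -> : (w - v) * (v + w) = - (q - p) * (q + p) + tau ^+ 2.
    by transitivity (- (v ^+ 2 - w ^+ 2)); [ring|rewrite vw; ring].
  rewrite (le_trans (ler_normD _ _))// normrM normrN.
  rewrite [`|q + p|]ger0_norm ?addr_ge0// [`|tau ^+ 2|]ger0_norm ?sqr_ge0//.
  rewrite mulrDl lerD//.
    by apply: ler_pM; rewrite ?addr_ge0// lerD.
  by rewrite expr2 ler_wpM2l ?(ltW tau0)// (le_trans tauw)// lerDr ltW.
have h1 : e / w - e / v <= p * q * (r + tau) / (v * w).
  have -> : e / w - e / v = e * (v - w) / (v * w) by field; rewrite !gt_eqF.
  rewrite ler_pM2r ?invr_gt0// (le_trans (ler_norm _))// normrM distrC.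
  by apply: ler_pM.
set a := q / v; set b := p * (r + tau) / w.
have h2 : p * q * (r + tau) / (v * w) = a * b.
  by rewrite /a /b; field; rewrite !gt_eqF.
(* Young's inequality, weighted so that when [r ^+ 2] has mean at most [tau ^+ 2], the last term
   costs at most [p ^+ 2 / (2 * w)] in mean. *)
have h3 : a * b <= 2 * tau * a ^+ 2 + b ^+ 2 / (8 * tau).
  have -> : b ^+ 2 / (8 * tau) = 2 * tau * (b / (4 * tau)) ^+ 2.
    by field; rewrite gt_eqF.
  have {1}-> : b = 4 * tau * (b / (4 * tau)) by field; rewrite gt_eqF.
  have := mulr_ge0 (ltW tau0) (sqr_ge0 (a - b / (4 * tau))).
  lra.
(* [(r + tau) ^+ 2 <= 2 * (r ^+ 2 + tau ^+ 2)], and one factor [w] of the denominator is lowered to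
   [tau]. *)
have h4 : b ^+ 2 / (8 * tau) <=
    p ^+ 2 * (r ^+ 2 + tau ^+ 2) / (4 * tau ^+ 2 * w).
  have -> : b ^+ 2 / (8 * tau) = p ^+ 2 * (r + tau) ^+ 2 / (8 * tau * w ^+ 2).
    by rewrite /b; field; rewrite !gt_eqF.
  have -> : p ^+ 2 * (r ^+ 2 + tau ^+ 2) / (4 * tau ^+ 2 * w) =
      p ^+ 2 * (2 * (r ^+ 2 + tau ^+ 2)) / (8 * tau * (tau * w)).
    by field; rewrite !gt_eqF.
  apply: ler_pM; rewrite ?invr_ge0.
  - by rewrite mulr_ge0 ?sqr_ge0.
  - by rewrite !mulr_ge0 ?sqr_ge0// ltW.
  - apply: ler_wpM2l; rewrite ?sqr_ge0//.
    by have := sqr_ge0 (r - tau); lra.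
  - rewrite lef_pV2 ?posrE; last 2 first.
      by rewrite !mulr_gt0// exprn_gt0.
      by rewrite !mulr_gt0.
    apply: ler_wpM2l; first by rewrite mulr_ge0// ltW.
    by rewrite expr2 ler_pM2r.
have -> : q ^+ 2 / v ^+ 2 = a ^+ 2 by rewrite /a expr_div_n.
lra.
Qed.

(** This is [ln (1 + y) <= y] at [y = - (b / (a + b))]; it makes the sum of the relative increments
    of [acc] telescope. *)
Lemma div_le_ln (a b : R) : 0 < a -> 0 <= b -> b / (a + b) <= ln (a + b) - ln a.
Proof.
move=> a0 b0; have ab0 : 0 < a + b by rewrite ltr_pwDl.
have e : 1 + - (b / (a + b)) = a / (a + b) by field; rewrite gt_eqF.
rewrite -lerN2 opprB -ln_div ?posrE// -e le_ln1Dx//.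
by rewrite -subr_gt0 opprK addrC e divr_gt0.
Qed.

(** By concavity [ln] lies below its tangent at [b]. An affine bound for the logarithm of a random
    quantity takes the place of Jensen's inequality. *)
Lemma ln_le_tangent (a b : R) : 0 < a -> 0 < b -> ln a <= ln b + a / b - 1.
Proof.
move=> a0 b0; have ab0 : 0 < a / b by rewrite divr_gt0.
have -> : ln a = ln (1 + (a / b - 1)) + ln b.
  by rewrite [1 + _]addrC subrK ln_div ?posrE// subrK.
by have := @le_ln1Dx R (a / b - 1); rewrite ltrBrDr addNr => /(_ ab0); lra.
Qed.

Lemma sqrtrD_le (a b : R) : 0 <= a -> 0 <= b ->
  Num.sqrt (a + b) <= Num.sqrt a + Num.sqrt b.
Proof.
move=> a0 b0; rewrite -(@ler_pXn2r _ 2)// ?nnegrE ?addr_ge0 ?sqrtr_ge0//.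
rewrite sqrrD !sqr_sqrtr ?addr_ge0// lerD2r lerDl.
by rewrite mulrn_wge0// mulr_ge0 ?sqrtr_ge0.
Qed.

(** The bound is affine in [a], so that it can be averaged; it is sharp at [a = m ^+ 2]. *)
Lemma sqrtr_le_amgm (a m : R) : 0 <= a -> 0 < m ->
  Num.sqrt a <= a / (2 * m) + m / 2.
Proof.
move=> a0 m0; rewrite -(@ler_pM2r _ (2 * m)) ?mulr_gt0//.
have -> : (a / (2 * m) + m / 2) * (2 * m) = a + m ^+ 2 by field; rewrite gt_eqF.
by rewrite -{2}(sqr_sqrtr a0); have := sqr_ge0 (Num.sqrt a - m); lra.
Qed.

(* From [S <= Q * w] with [w] growing like [2 * sqrt S], the square root of [S]
   is bounded linearly in [Q]; [c] balances the two terms. *)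
Lemma sqrtr_le_linear (S Q w c b : R) : 0 <= S -> 0 < w -> 2 <= c ->
  S <= Q * w -> w <= b + 2 * Num.sqrt S -> Num.sqrt S <= c * Q + b / c.
Proof.
move=> S0 w0 c2 SQ wb; set s := Num.sqrt S.
have c0 : 0 < c by apply: lt_le_trans c2.
have s0 : 0 <= s := sqrtr_ge0 _.
have Ss : s ^+ 2 = S by rewrite sqr_sqrtr.
(* After multiplication by [w], this follows from [0 <= (c * s - w) ^+ 2] and [S <= Q * w]. *)
have h1 : 2 * s <= c * Q + w / c.
  rewrite -(ler_pM2r w0).
  have h : c * (Q * w) >= c * s ^+ 2 by rewrite Ss ler_pM2l.
  have e : c * s ^+ 2 + w ^+ 2 / c - 2 * s * w = (c * s - w) ^+ 2 / c.
    by field; rewrite gt_eqF.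
  have : 0 <= (c * s - w) ^+ 2 / c by rewrite divr_ge0 ?sqr_ge0// ltW.
  have -> : (c * Q + w / c) * w = c * (Q * w) + w ^+ 2 / c by field; rewrite gt_eqF.
  lra.
(* As [2 <= c], the growth [2 * s] of [w] contributes at most [s] after division by [c]. *)
have h2 : w / c <= b / c + s.
  rewrite ler_pdivrMr// mulrDl divfK ?gt_eqF// (le_trans wb)// lerD2l mulrC.
  by rewrite ler_wpM2l.
lra.
Qed.

End ScalarEstimates.

(** * Pathwise analysis of AdaGrad-norm *)

Section Path.
Context {R : realType} {d : nat} (f : 'rV[R]_d -> R) (xmin : 'rV[R]_d).
Variables (ell eta v0 tau : R) (x gs : nat -> 'rV[R]_d).
Hypotheses (ell0 : 0 < ell) (fs : smooth ell f) (fmin : forall y, f xmin <= f y).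
Hypotheses (eta0 : 0 < eta) (v00 : 0 < v0) (tau0 : 0 < tau).
Hypothesis xS : forall t, x t.+1 = x t - adagrad_stepsize eta v0 gs t *: gs t.

Let G t := grad f (x t).
Let noise t := gs t - G t.
Let acc t := v0 ^+ 2 + \sum_(k < t) enorm (gs k) ^+ 2.
Let w t := Num.sqrt (acc t + enorm (G t) ^+ 2 + tau ^+ 2).

Let accS t : acc t.+1 = acc t + enorm (gs t) ^+ 2.
Proof. by rewrite /acc big_ord_recr/= addrA. Qed.

Let acc_gt0 t : 0 < acc t.
Proof.
rewrite ltr_pwDl ?exprn_gt0//.
by apply: sumr_ge0 => k _; exact: sqr_ge0.
Qed.

Let sqrt_acc_gt0 t : 0 < Num.sqrt (acc t).
Proof. by rewrite sqrtr_gt0 acc_gt0. Qed.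

Let le_gs_acc t : enorm (gs t) <= Num.sqrt (acc t.+1).
Proof.
rewrite -[leLHS]ger0_norm ?enorm_ge0// -sqrtr_sqr ler_wsqrtr// accS.
by rewrite lerDr (ltW (acc_gt0 t)).
Qed.

Let w_sqr t : w t ^+ 2 = acc t + enorm (G t) ^+ 2 + tau ^+ 2.
Proof. by rewrite sqr_sqrtr// addr_ge0 ?sqr_ge0// addr_ge0 ?sqr_ge0// (ltW (acc_gt0 t)). Qed.

Let le_G_w t : enorm (G t) <= w t.
Proof.
rewrite -[leLHS]ger0_norm ?enorm_ge0// -sqrtr_sqr ler_wsqrtr//.
by rewrite -addrA addrCA lerDl addr_ge0 ?sqr_ge0// (ltW (acc_gt0 t)).
Qed.

Let le_tau_w t : tau <= w t.
Proof.
rewrite -[leLHS]gtr0_norm// -sqrtr_sqr ler_wsqrtr//.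
by rewrite lerDr addr_ge0 ?sqr_ge0// (ltW (acc_gt0 t)).
Qed.

Let w_gt0 t : 0 < w t.
Proof. exact: lt_le_trans (le_tau_w t). Qed.

(** The stepsize denominator contains the current stochastic gradient, so an iterate moves by at
    most [eta]. The bound holds on every path, whatever the noise. *)
Lemma enorm_grad_path t :
  enorm (grad f (x t)) <= enorm (grad f (x 0%N)) + ell * eta * t%:R.
Proof.
elim: t => [|t IH]; first by rewrite mulr0 addr0.
have h : enorm (x t.+1 - x t) <= eta.
  rewrite xS addrAC subrr add0r enormN enormZ /adagrad_stepsize -/(acc t.+1).
  rewrite ger0_norm ?divr_ge0 ?sqrtr_ge0 ?(ltW eta0)//.
  rewrite -mulrA ler_piMr ?(ltW eta0)// mulrC ler_pdivrMr ?sqrt_acc_gt0//.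
  by rewrite mul1r le_gs_acc.
have h1 : enorm (grad f (x t.+1) - grad f (x t)) <= ell * eta.
  by rewrite (le_trans (fs.2 _ _))// ler_pM2l.
have := ler_enormD (grad f (x t.+1) - grad f (x t)) (grad f (x t)).
by rewrite subrK mulrS; lra.
Qed.

(** The weight that [decorrelation] gives to the squared noise; it depends on the past only. *)
Let h t := enorm (G t) ^+ 2 / (4 * tau ^+ 2 * w t).

Lemma adagrad_step t :
  1 / 2 * (enorm (G t) ^+ 2 / w t) <=
    (f (x t) - f (x t.+1)) / eta
    + (2 * tau + ell * eta) * (ln (acc t.+1) - ln (acc t))
    + (h t * (enorm (noise t) ^+ 2 - tau ^+ 2) - dot (G t) (noise t) / w t).
Proof.
have v0' := sqrt_acc_gt0 t.+1.
have sv : Num.sqrt (acc t.+1) ^+ 2 = acc t.+1 by rewrite sqr_sqrtr// (ltW (acc_gt0 _)).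
have := @decorrelation R (enorm (G t)) (enorm (gs t)) (enorm (noise t)) tau
  (Num.sqrt (acc t.+1)) (w t) (dot (G t) (gs t)) (enorm_ge0 _) (enorm_ge0 _) tau0
  v0' (le_gs_acc t) (le_G_w t) (le_tau_w t) _ (ler_enormB _ _) (abs_dot_le _ _).
rewrite sv w_sqr accS.
have -> : acc t + enorm (gs t) ^+ 2 - (acc t + enorm (G t) ^+ 2 + tau ^+ 2) =
  enorm (gs t) ^+ 2 - enorm (G t) ^+ 2 - tau ^+ 2 by ring.
move=> /(_ erefl); rewrite -accS => dec.
have lnh : enorm (gs t) ^+ 2 / acc t.+1 <= ln (acc t.+1) - ln (acc t).
  by rewrite accS div_le_ln ?acc_gt0 ?sqr_ge0.
have desc := descent ell0 fs (x t) (x t.+1).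
have e : x t.+1 - x t = - (adagrad_stepsize eta v0 gs t *: gs t).
  by rewrite xS addrAC subrr add0r.
move: desc; rewrite e enormN enormZ exprMn real_normK ?num_real// dotNr dotZr.
rewrite /adagrad_stepsize -/(acc t.+1) -/(G t) expr_div_n sv => desc.
have desc' : dot (G t) (gs t) / Num.sqrt (acc t.+1) <=
    (f (x t) - f (x t.+1)) / eta + ell * eta * (enorm (gs t) ^+ 2 / acc t.+1).
  rewrite -(ler_pM2r eta0) mulrDl divfK ?gt_eqF//; lra.
have ge : dot (G t) (gs t) = enorm (G t) ^+ 2 + dot (G t) (noise t).
  by rewrite enorm_sqr -dotDr /noise addrC subrK.
(* Centring the squared noise at [tau ^+ 2] leaves [2 * tau ^+ 2] over [4 * tau ^+ 2], that is, half
   of the descent term. *)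
have k1 : enorm (G t) ^+ 2 * (enorm (noise t) ^+ 2 + tau ^+ 2) /
     (4 * tau ^+ 2 * w t) =
     h t * (enorm (noise t) ^+ 2 - tau ^+ 2) + 1 / 2 * (enorm (G t) ^+ 2 / w t).
  by rewrite /h; field; rewrite !gt_eqF ?w_gt0.
have k2 : dot (G t) (gs t) / w t =
    enorm (G t) ^+ 2 / w t + dot (G t) (noise t) / w t.
  by rewrite ge mulrDl.
have c0 : 0 <= 2 * tau + ell * eta.
  by rewrite addr_ge0// mulr_ge0// ltW.
have := ler_wpM2l c0 lnh.
rewrite k1 k2 in dec; lra.
Qed.

Lemma adagrad_path T :
  1 / 2 * (\sum_(t < T) enorm (G t) ^+ 2 / w t) <=
    (f (x 0%N) - f (x T)) / eta
    + (2 * tau + ell * eta) * (ln (acc T) - ln (acc 0))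
    + \sum_(t < T) (h t * (enorm (noise t) ^+ 2 - tau ^+ 2)
                    - dot (G t) (noise t) / w t).
Proof.
elim: T => [|T IH]; first by rewrite !big_ord0 !subrr mul0r !mulr0 !addr0.
rewrite !big_ord_recr/=; have := adagrad_step T.
have -> : (f (x 0%N) - f (x T.+1)) / eta =
  (f (x 0%N) - f (x T)) / eta + (f (x T) - f (x T.+1)) / eta by ring.
lra.
Qed.

Lemma acc_le T : acc T <= v0 ^+ 2 + 2 * (\sum_(t < T) enorm (G t) ^+ 2)
  + 2 * (\sum_(t < T) enorm (noise t) ^+ 2).
Proof.
rewrite -addrA lerD2l !mulr_sumr -big_split/=; apply: ler_sum => t _.
by rewrite -[gs t](subrK (G t)) addrC enormD_sqr_le.
Qed.

(* The right-hand side is affine in the mean-nonpositive quantities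
   [enorm (noise t) ^+ 2 - tau ^+ 2] and [dot (G t) (noise t)]. *)
Lemma adagrad_path_bound (T : nat) (Gam M Delta c m : R) :
  f (x 0%N) - f xmin <= Delta -> 0 < M -> 2 <= c ->
  (forall t, (t < T)%N -> enorm (G t) <= Gam) ->
  v0 ^+ 2 + 2 * T%:R * Gam ^+ 2 + 2 * T%:R * tau ^+ 2 <= v0 ^+ 2 * M ->
  0 < m -> m ^+ 2 = 2 * T%:R * tau ^+ 2 ->
  Num.sqrt (\sum_(t < T) enorm (G t) ^+ 2) <=
    c * (2 * (Delta / eta + (2 * tau + ell * eta) * ln M)) + (v0 + tau + m) / c
    + \sum_(t < T)
       ((2 * c * h t + 4 * c * (2 * tau + ell * eta) / (v0 ^+ 2 * M) + (m * c)^-1)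
          * (enorm (noise t) ^+ 2 - tau ^+ 2)
        - 2 * c * (dot (G t) (noise t) / w t)).
Proof.
move=> fD M0 c2 GGam hM m0 m2.
have c0 : 0 < c by apply: lt_le_trans c2.
set K := 2 * tau + ell * eta.
have K0 : 0 < K by rewrite addr_gt0// mulr_gt0.
have v2M0 : 0 < v0 ^+ 2 * M by rewrite mulr_gt0// exprn_gt0.
have path := adagrad_path T; have accT := acc_le T.
rewrite -/K in path.
set S := \sum_(t < T) enorm (G t) ^+ 2 in accT *.
set N := \sum_(t < T) enorm (noise t) ^+ 2 in accT.
set Q := \sum_(t < T) enorm (G t) ^+ 2 / w t in path.
set B := \sum_(t < T) (h t * (enorm (noise t) ^+ 2 - tau ^+ 2)
                    - dot (G t) (noise t) / w t) in path.
(* The excess of the squared noise over the bound on its mean; every later estimate is kept linear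
   in it. *)
pose D := \sum_(t < T) (enorm (noise t) ^+ 2 - tau ^+ 2).
have S0 : 0 <= S by apply: sumr_ge0 => t _; exact: sqr_ge0.
have N0 : 0 <= N by apply: sumr_ge0 => t _; exact: sqr_ge0.
have ND : N = D + T%:R * tau ^+ 2.
  rewrite /D big_split/= sumrN -/N sumr_const card_ord.
  by rewrite mulr_natl subrK.
have SG : S <= T%:R * Gam ^+ 2.
  rewrite mulr_natl -[T in leRHS]card_ord -sumr_const; apply: ler_sum => t _.
  by rewrite lerXn2r ?nnegrE ?enorm_ge0 ?GGam// (le_trans (enorm_ge0 (G t))) ?GGam.
(* Tangent at [v0 ^+ 2 * M], which [acc T] exceeds by at most [2 * D] by the choice of [M]. *)
have lnT : ln (acc T) - ln (acc 0) <= ln M + 2 * D / (v0 ^+ 2 * M).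
  have -> : acc 0 = v0 ^+ 2 by rewrite /acc big_ord0 addr0.
  have := ln_le_tangent (acc_gt0 T) v2M0.
  rewrite lnM ?posrE ?exprn_gt0//.
  have : acc T / (v0 ^+ 2 * M) <= 1 + 2 * D / (v0 ^+ 2 * M).
    by rewrite ler_pdivrMr// mulrDl divfK ?gt_eqF// mul1r; lra.
  lra.
have Q2 : Q <= 2 * (Delta / eta + K * ln M) + 4 * K / (v0 ^+ 2 * M) * D + 2 * B.
  have h1 : (f (x 0%N) - f (x T)) / eta <= Delta / eta.
    by rewrite ler_pM2r ?invr_gt0//; have := fmin (x T); lra.
  have := ler_wpM2l (ltW K0) lnT.
  have -> : K * (ln M + 2 * D / (v0 ^+ 2 * M)) =
     K * ln M + 2 * K / (v0 ^+ 2 * M) * D by ring.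
  have -> : 4 * K / (v0 ^+ 2 * M) * D = 2 * (2 * K / (v0 ^+ 2 * M) * D) by ring.
  lra.
(* A single denominator for the whole path: [acc t <= acc T], [acc_le] and the bound of each squared
   gradient by [S] show that [W] dominates every [w t]. *)
set W := Num.sqrt (v0 ^+ 2 + 2 * N + 3 * S + tau ^+ 2).
have W0 : 0 < W.
  by rewrite sqrtr_gt0 ltr_wpDl ?exprn_gt0// !addr_ge0 ?sqr_ge0 ?mulr_ge0.
have SQW : S <= Q * W.
  rewrite mulr_suml; apply: ler_sum => t _.
  rewrite -mulrA ler_peMr ?sqr_ge0// mulrC ler_pdivlMr ?w_gt0// mul1r.
  rewrite ler_wsqrtr// lerD2r.
  have h1 : acc t <= acc T.
    rewrite lerD2l [leRHS](bigID (fun k : 'I_T => (k < t)%N))/=.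
    rewrite [X in _ <= X + _](_ : _ = \sum_(k < t) enorm (gs k) ^+ 2); last first.
      by rewrite (big_ord_widen T (fun k => enorm (gs k) ^+ 2))// ltnW.
    by rewrite lerDl sumr_ge0// => k _; exact: sqr_ge0.
  have h2 : enorm (G t) ^+ 2 <= S.
    by rewrite /S (bigD1 t)//= lerDl sumr_ge0// => k _; exact: sqr_ge0.
  lra.
(* For [D = 0] one has [2 * N = m ^+ 2], where [sqrtr_le_amgm] is sharp; in general it yields
   [m + D / m]. *)
have Wb : W <= v0 + tau + m + D / m + 2 * Num.sqrt S.
  have sq2 : Num.sqrt (v0 ^+ 2) = v0 by rewrite sqrtr_sqr gtr0_norm.
  have st : Num.sqrt (tau ^+ 2) = tau by rewrite sqrtr_sqr gtr0_norm.
  have s3 : Num.sqrt (3 * S) <= 2 * Num.sqrt S.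
    rewrite -[X in _ <= X * _](ger0_norm (ler0n R 2)) -sqrtr_sqr -sqrtrM ?sqr_ge0//.
    by rewrite ler_wsqrtr//; lra.
  have n2 : 0 <= 2 * N by rewrite mulr_ge0.
  have n3 : 0 <= 3 * S by rewrite mulr_ge0.
  have a1 := sqrtrD_le (addr_ge0 (addr_ge0 (sqr_ge0 v0) n2) n3) (sqr_ge0 tau).
  have a2 := sqrtrD_le (addr_ge0 (sqr_ge0 v0) n2) n3.
  have a3 := sqrtrD_le (sqr_ge0 v0) n2.
  have a4 := sqrtr_le_amgm n2 m0.
  have a5 : 2 * N / (2 * m) + m / 2 = m + D / m.
    rewrite ND; have -> : T%:R * tau ^+ 2 = m ^+ 2 / 2 by rewrite m2; field.
    by field; rewrite gt_eqF.
  rewrite /W; lra.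
have := sqrtr_le_linear S0 W0 c2 SQW Wb.
have -> : \sum_(t < T)
       ((2 * c * h t + 4 * c * K / (v0 ^+ 2 * M) + (m * c)^-1)
          * (enorm (noise t) ^+ 2 - tau ^+ 2)
        - 2 * c * (dot (G t) (noise t) / w t)) =
    2 * c * B + (4 * c * K / (v0 ^+ 2 * M) + (m * c)^-1) * D.
  by rewrite !mulr_sumr -big_split/=; apply: eq_bigr => t _; ring.
have := ler_wpM2l (ltW c0) Q2.
have -> : (v0 + tau + m + D / m) / c = (v0 + tau + m) / c + (m * c)^-1 * D.
  by field; rewrite !gt_eqF.
have -> : c * (2 * (Delta / eta + K * ln M) + 4 * K / (v0 ^+ 2 * M) * D + 2 * B) =
  c * (2 * (Delta / eta + K * ln M)) + 4 * c * K / (v0 ^+ 2 * M) * D + 2 * c * B.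
  by ring.
lra.
Qed.

End Path.

(** * Independence and Fubini for a chain driven by iid samples *)

Section MarkovChain.
Context {R : realType} {dO dX dY : measure_display}
  {Omega : measurableType dO} {Xi : measurableType dX} {Y : measurableType dY}.
Variables (P : probability Omega R) (D : probability Xi R) (xi : nat -> Omega -> Xi).
Variables (y0 : Y) (F : Y * Xi -> Y) (X : nat -> Omega -> Y).
Hypotheses (iid : iid_samples P D xi) (mF : measurable_fun setT F).
Hypotheses (X0 : forall w, X 0%N w = y0).
Hypothesis XS : forall t w, X t.+1 w = F (X t w, xi t w).

Lemma measurable_chain t : measurable_fun setT (X t).
Proof.
have [mxi _ _] := iid.
elim: t => [|t IH].
  by rewrite (_ : X 0 = cst y0)//; apply/funext => w; rewrite X0.
rewrite (_ : X t.+1 = F \o (fun w => (X t w, xi t w))); last first.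
  by apply/funext => w; rewrite XS.
by apply: measurableT_comp => //; exact: measurable_fun_pair.
Qed.

Lemma measurable_chain_sample t : measurable_fun setT (fun w => (X t w, xi t w)).
Proof. by have [mxi _ _] := iid; exact: measurable_fun_pair (measurable_chain t) _. Qed.

Definition chain_RV t : {RV P >-> Y} :=
  HB.pack_for {RV P >-> Y} (X t) (isMeasurableFun.Build _ _ _ _ _ (measurable_chain t)).

Let joint_RV t : {RV P >-> (Y * Xi)%type} :=
  HB.pack_for {RV P >-> (Y * Xi)%type} (fun w => (X t w, xi t w))
    (isMeasurableFun.Build _ _ _ _ _ (measurable_chain_sample t)).

Let future (s : seq nat) (C : nat -> set Xi) : set Omega :=
  \bigcap_(i in [set` s]) (xi i @^-1` C i).

Let measurable_future s C : (forall i, measurable (C i)) -> measurable (future s C).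
Proof.
have [mxi _ _] := iid => mC.
apply: bigcap_measurableType => i _.
by have := mxi i measurableT _ (mC i); rewrite setTI.
Qed.

(** All samples of index at least [t] are treated jointly, because the induction on [t] consumes the
    sample at [t] and must keep the later ones. *)
Let independent_at t := forall s (B : set Y) C, uniq s ->
  (forall i, i \in s -> (t <= i)%N) -> measurable B -> (forall i, measurable (C i)) ->
  P (X t @^-1` B `&` future s C) = (P (X t @^-1` B) * \prod_(i <- s) D (C i))%E.

(** For a fixed future event both sides are measures in [A]. They agree on rectangles by
    [independent_at], hence everywhere by uniqueness of product measures. *)
Let joint_law t : independent_at t -> forall s (A : set (Y * Xi)) C, uniq s ->
  (forall i, i \in s -> (t < i)%N) -> measurable A -> (forall i, measurable (C i)) ->
  P ((fun w => (X t w, xi t w)) @^-1` A `&` future s C) =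
    ((distribution P (chain_RV t) \x D)%E A * \prod_(i <- s) D (C i))%E.
Proof.
move=> indep s A C us st mA mC.
have [mxi lxi _] := iid.
have D01 B : measurable B -> D B \is a fin_num by move=> mB; exact: fin_num_measure.
pose q := fine (\prod_(i <- s) D (C i))%E.
have qE : (\prod_(i <- s) D (C i))%E = q%:E.
  rewrite fineK//.
  elim/big_ind : _ => // [a b fa fb|i _]; [exact: fin_numM | exact: D01].
have q0 : 0 <= q.
  by apply: fine_ge0; apply: prode_ge0 => i _.
pose qn := NngNum q0.
pose E := future s C; have mE : measurable E by exact: measurable_future.
(* Restricting [P] to [E] before pushing forward makes the left-hand side a measure in [A]. *)
have [m' m'E] : {m' : {measure set (Y * Xi) -> \bar R} | forall A,
    m' A = P ((fun w => (X t w, xi t w)) @^-1` A `&` E)}.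
  pose m : {measure set (Y * Xi) -> \bar R} :=
    pushforward (mrestr P mE) (joint_RV t).
  by exists (m (measurable_chain_sample t)).
(* The constant factor [q] is absorbed as a scaling of [D], so that the right-hand side is a product
   measure. *)
have := @product_measure_unique _ _ _ _ R (distribution P (chain_RV t)) (mscale qn D) m'.
rewrite -m'E => /(_ _ A mA) <-; last first.
  move=> B B' mB mB'.
  (* The sample at [t] joins the future ones; since [t] is not in [s], their constraints are
     unchanged. *)
  pose C' i := if i == t then B' else C i.
  have C't : C' t = B' by rewrite /C' eqxx.
  have eC' i : i \in s -> C' i = C i.
    by rewrite /C'; case: eqP => // -> /st; rewrite ltnn.
  have := indep (t :: s) B C' _ _ mB _.
  rewrite big_cons C't (eq_big_seq _ (fun i si => congr1 D (eC' i si))) qE.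
  rewrite /= us andbT => h.
  transitivity (P (X t @^-1` B `&` future (t :: s) C')).
    rewrite m'E; congr (P _).
    rewrite /E /future !bigcap_seq big_cons setIA C't; congr (_ `&` _).
    by apply: eq_big_seq => i si; rewrite eC'.
  rewrite h//.
  - by rewrite [(D B' * _)%E]muleC.
  - by apply/negP => /st; rewrite ltnn.
  - by move=> i; rewrite inE => /orP[/eqP->//|/st/ltnW].
  - by move=> i; rewrite /C'; case: ifP.
rewrite /= /product_measure1/= qE.
under eq_integral do rewrite /mscale/=.
rewrite ge0_integralZl//; first by rewrite muleC.
exact: measurable_fun_xsection.
Qed.

Lemma chain_independent t : independent_at t.
Proof.
have [mxi lxi indxi] := iid.
elim: t => [|t IH] s B C us st mB mC.
  have E : P (future s C) = (\prod_(i <- s) D (C i))%E.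
    rewrite /future indxi//; apply: eq_big_seq => i _; exact: lxi.
  (* The initial state is deterministic, so the event is sure or impossible. *)
  have [By|nBy] := pselect (B y0).
    have -> : X 0 @^-1` B = setT by apply/seteqP; split => w //= _; rewrite X0.
    by rewrite setTI E probability_setT mul1e.
  have -> : X 0 @^-1` B = set0 by apply/seteqP; split => w //=; rewrite X0.
  by rewrite set0I measure0 mul0e.
have mFB : measurable (F @^-1` B) by have := mF measurableT mB; rewrite setTI.
have XF : X t.+1 @^-1` B = (fun w => (X t w, xi t w)) @^-1` (F @^-1` B).
  by apply/seteqP; split => w /=; rewrite XS.
rewrite XF joint_law//.
have := joint_law IH (s := [::]) (C := C) isT _ mFB mC.
by rewrite big_nil mule1 /future set_nil bigcap_set0 setIT => ->.
Qed.

Lemma chain_sample_law t (A : set (Y * Xi)) : measurable A ->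
  P ((fun w => (X t w, xi t w)) @^-1` A) = (distribution P (chain_RV t) \x D)%E A.
Proof.
move=> mA.
have := joint_law (chain_independent (t := t)) (s := [::]) (C := fun=> setT) isT _ mA.
by rewrite big_nil mule1 /future set_nil bigcap_set0 setIT => ->.
Qed.

(** Change of variables to the joint law, which is a product by [chain_sample_law], then Fubini. *)
Lemma chain_expectation t (phi : Y * Xi -> R) : measurable_fun setT phi ->
  (distribution P (chain_RV t) \x D)%E.-integrable setT (EFin \o phi) ->
  P.-integrable setT (fun w => (phi (X t w, xi t w))%:E) /\
  (\int[P]_w (phi (X t w, xi t w))%:E =
   \int[distribution P (chain_RV t)]_y \int[D]_z (phi (y, z))%:E)%E.
Proof.
move=> mphi iphi.
have lawE A : measurable A -> A `<=` setT ->
    distribution P (joint_RV t) A = (distribution P (chain_RV t) \x D)%E A.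
  by move=> mA _; exact: chain_sample_law.
have mEphi : measurable_fun setT (fun p => (phi p)%:E) by exact/measurable_EFinP.
have iP : P.-integrable setT (fun w => (phi (X t w, xi t w))%:E).
  apply/integrableP; split.
    by apply: (measurableT_comp mEphi); exact: measurable_chain_sample.
  have := @ge0_integral_distribution _ _ _ _ _ P (joint_RV t)
    (fun p => `|(phi p)%:E|%E).
  move=> /= <- //; last first.
  by apply/measurable_EFinP; exact: measurableT_comp.
  rewrite (eq_measure_integral _ lawE).
  by case/integrableP : iphi.
split => //.
rewrite (integral12_prod_meas1 iphi) -(eq_measure_integral _ lawE).
by rewrite integral_distribution.
Qed.

End MarkovChain.

(** * Measurability, moments and drift of the gradient noise *)

Section Oracle.
Context {R : realType} {d : nat} {dX : measure_display} {Xi : measurableType dX}.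
Variables (D : probability Xi R) (tau : R) (f : 'rV[R]_d -> R).
Variable g : 'rV[R]_d -> Xi -> 'rV[R]_d.
Hypothesis oracle : stochastic_gradient D tau f g.

Let row (y : d.-tuple R) : 'rV[R]_d := \row_i tnth y i.
Let noise (y : d.-tuple R) (z : Xi) := g (row y) z - grad f (row y).

Lemma measurable_enorm_sqr {dY} (Y : measurableType dY) (h : Y -> 'rV[R]_d) :
  (forall j, measurable_fun setT (fun y => h y 0 j)) ->
  measurable_fun setT (fun y => enorm (h y) ^+ 2).
Proof.
move=> mh; under eq_fun do rewrite enorm_sqr.
by apply: measurable_sum => j; exact: measurable_funM.
Qed.

Lemma measurable_dot {dY} (Y : measurableType dY) (h1 h2 : Y -> 'rV[R]_d) :
  (forall j, measurable_fun setT (fun y => h1 y 0 j)) ->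
  (forall j, measurable_fun setT (fun y => h2 y 0 j)) ->
  measurable_fun setT (fun y => dot (h1 y) (h2 y)).
Proof. by move=> mh1 mh2; apply: measurable_sum => j; exact: measurable_funM. Qed.

(* No continuity of the gradient is needed: as a mean of the oracle it is
   measurable by the Fubini-Tonelli theorem. *)
Lemma measurable_grad j : measurable_fun setT (fun y => grad f (row y) 0 j).
Proof.
have [mg ig eg _] := oracle.
have mgj : measurable_fun setT (fun p : d.-tuple R * Xi => (g (row p.1) p.2 0 j)%:E).
  by apply/measurable_EFinP; exact: mg.
rewrite (_ : (fun y => _) = fine \o
    (fun y => (\int[D]_z ((fun p => (g (row p.1) p.2 0 j)%:E)^\+ (y, z))
       - \int[D]_z ((fun p => (g (row p.1) p.2 0 j)%:E)^\- (y, z)))%E)); last first.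
  apply/funext => y /=; have := eg (row y) j.
  rewrite unlock integralE => e.
  transitivity (fine (grad f (row y) 0 j)%:E) => //; rewrite -e.
  by congr (fine (_ - _)); apply: eq_integral => z _; rewrite !(funeposE,funenegE).
apply: measurableT_comp => //; apply: emeasurable_funB.
- apply: (@measurable_fun_fubini_tonelli_F _ _ _ _ _ D) => //.
  exact: measurable_funepos.
- apply: (@measurable_fun_fubini_tonelli_F _ _ _ _ _ D) => //.
  exact: measurable_funeneg.
Qed.

Let noiseE y z j : noise y z 0 j = g (row y) z 0 j - grad f (row y) 0 j.
Proof. by rewrite /noise mxE [X in _ + X]mxE. Qed.

Lemma measurable_gradient_sample j :
  measurable_fun setT (fun p : (d.-tuple R * R) * Xi => g (row p.1.1) p.2 0 j).
Proof.
have [mg _ _ _] := oracle.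
apply: (measurableT_comp (mg j)
  (g := fun p : (d.-tuple R * R) * Xi => (p.1.1, p.2))).
apply: measurable_fun_pair => //.
exact: (measurableT_comp measurable_fst measurable_fst).
Qed.

Lemma measurable_noise j :
  measurable_fun setT (fun p : (d.-tuple R * R) * Xi => noise p.1.1 p.2 0 j).
Proof.
under eq_fun do rewrite noiseE.
apply: measurable_funB; first exact: measurable_gradient_sample.
apply: (measurableT_comp (measurable_grad j)
  (g := fun p : (d.-tuple R * R) * Xi => p.1.1)).
exact: (measurableT_comp measurable_fst measurable_fst).
Qed.

Let noise_integrable y j : D.-integrable setT (fun z => (noise y z 0 j)%:E).
Proof.
have [_ ig _ _] := oracle.
under eq_fun do rewrite noiseE EFinB.
by apply: integrableB => //; exact: finite_measure_integrable_cst.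
Qed.

Let noise_mean y j : (\int[D]_z (noise y z 0 j)%:E = 0)%E.
Proof.
have [_ ig eg _] := oracle.
under eq_integral do rewrite noiseE EFinB.
rewrite integralB_EFin//; [|exact: ig|exact: finite_measure_integrable_cst].
have := eg (row y) j; rewrite unlock => ->.
by rewrite integral_cst//= probability_setT mule1 subee.
Qed.

Let dot_noise_integrable y h : D.-integrable setT (fun z => (dot h (noise y z))%:E).
Proof.
under eq_fun do rewrite -sumEFin.
apply: integrable_sum => // j _; under eq_fun do rewrite EFinM.
exact: integrableZl.
Qed.

Let dot_noise_mean y h : (\int[D]_z (dot h (noise y z))%:E = 0)%E.
Proof.
under eq_integral do rewrite -sumEFin.
rewrite integral_sum//; last first.
  move=> j; under eq_fun do rewrite EFinM.
  exact: integrableZl.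
rewrite big1// => j _; under eq_integral do rewrite EFinM.
by rewrite integralZl// noise_mean mule0.
Qed.

Let measurable_noise_y y j : measurable_fun setT (fun z => noise y z 0 j).
Proof. by have /integrableP[/measurable_EFinP] := noise_integrable y j. Qed.

Let noise_variance y : (\int[D]_z (enorm (noise y z) ^+ 2)%:E <= (tau ^+ 2)%:E)%E.
Proof. by have [_ _ _ /(_ (row y))] := oracle; rewrite unlock. Qed.

Let noise_sqr_integrable y : D.-integrable setT (fun z => (enorm (noise y z) ^+ 2)%:E).
Proof.
apply/integrableP; split.
  by apply/measurable_EFinP; exact: measurable_enorm_sqr.
under eq_integral do rewrite gee0_abs ?lee_fin ?sqr_ge0//.
by rewrite (le_lt_trans (noise_variance y))// ltry.
Qed.

Variables (a : d.-tuple R * R -> R) (H : d.-tuple R * R -> 'rV[R]_d) (Ka KH : R).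
Hypotheses (ma : measurable_fun setT a) (a_ge0 : forall y, 0 <= a y).
Hypotheses (a_le : forall y, a y <= Ka).
Hypotheses (mH : forall j, measurable_fun setT (fun y => H y 0 j)).
Hypothesis H_le : forall y, enorm (H y) <= KH.

(** The form of one summand in [adagrad_path_bound]: the weights [a] and [H] see the state only, so
    they are constant when the sample is integrated out. *)
Let phi (p : (d.-tuple R * R) * Xi) : R :=
  a p.1 * (enorm (noise p.1.1 p.2) ^+ 2 - tau ^+ 2) - dot (H p.1) (noise p.1.1 p.2).

Lemma measurable_drift : measurable_fun setT phi.
Proof.
apply: measurable_funB.
  apply: measurable_funM.
    exact: (measurableT_comp ma measurable_fst).
  apply: measurable_funB => //; apply: measurable_enorm_sqr => j.
  exact: measurable_noise.
apply: measurable_dot => j; last exact: measurable_noise.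
exact: (measurableT_comp (mH j) measurable_fst).
Qed.

(** At a frozen state the linear term has mean zero and the variance is at most [tau ^+ 2], with a
    nonnegative weight. *)
Lemma drift_mean_le0 y : (\int[D]_z (phi (y, z))%:E <= 0)%E.
Proof.
rewrite /phi/=.
have i1 : D.-integrable setT
    (fun z => (a y * (enorm (noise y.1 z) ^+ 2 - tau ^+ 2))%:E).
  under eq_fun do rewrite EFinM EFinB.
  apply: integrableZl => //; apply: integrableB => //.
  exact: finite_measure_integrable_cst.
under eq_integral do rewrite EFinB.
rewrite integralB_EFin//; last exact: dot_noise_integrable.
rewrite dot_noise_mean sube0.
under eq_integral do rewrite EFinM.
rewrite integralZl//; last first.
  under eq_fun do rewrite EFinB.
  by apply: integrableB => //; exact: finite_measure_integrable_cst.
apply: mule_ge0_le0; rewrite ?lee_fin//.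
under eq_integral do rewrite EFinB.
rewrite integralB_EFin//; [|exact: noise_sqr_integrable|
  exact: finite_measure_integrable_cst].
rewrite integral_cst//= probability_setT mule1 leeBlDr// add0e.
exact: noise_variance.
Qed.

(** As [a] and [H] are bounded, [phi] is at most affine in the squared noise, so its absolute inner
    integral is bounded uniformly in the state. *)
Lemma drift_integrable (nu : probability (d.-tuple R * R)%type R) :
  (nu \x D)%E.-integrable setT (EFin \o phi).
Proof.
(* [(point, 0)] is an arbitrary state, at which a nonnegative quantity lies below the bound. *)
have Ka0 : 0 <= Ka by apply: le_trans (a_le (point, 0)).
have KH0 : 0 <= KH by apply: le_trans (H_le (point, 0)); exact: enorm_ge0.
pose K1 := Ka * tau ^+ 2 + KH; pose K2 := Ka + KH.
have K10 : 0 <= K1 by rewrite addr_ge0// mulr_ge0// sqr_ge0.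
have K20 : 0 <= K2 by rewrite addr_ge0.
have mphi := measurable_drift.
apply/integrable12ltyP; first exact/measurable_EFinP.
have phi_le p : `|phi p| <= K1 + K2 * enorm (noise p.1.1 p.2) ^+ 2.
  rewrite /phi; set n := enorm _.
  have n0 : 0 <= n := enorm_ge0 _.
  have h1 : `|dot (H p.1) (noise p.1.1 p.2)| <= enorm (H p.1) * n := abs_dot_le _ _.
  have h2 : enorm (H p.1) * n <= KH * (1 + n ^+ 2).
    apply: ler_pM => //; first exact: enorm_ge0.
    by have := sqr_ge0 (n - 1); have := sqr_ge0 n; lra.
  have h3 : `|a p.1 * (n ^+ 2 - tau ^+ 2)| <= Ka * (n ^+ 2 + tau ^+ 2).
    rewrite normrM ger0_norm//; apply: ler_pM => //.
    by rewrite (le_trans (ler_normB _ _))// !ger0_norm ?sqr_ge0.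
  apply: (le_trans (ler_normB _ _)).
  have -> : K1 + K2 * n ^+ 2 = Ka * (n ^+ 2 + tau ^+ 2) + KH * (1 + n ^+ 2).
    by rewrite /K1 /K2; ring.
  exact: lerD h3 (le_trans h1 h2).
have inner y : (\int[D]_z `|(phi (y, z))%:E| <= (K1 + K2 * tau ^+ 2)%:E)%E.
  have h : (\int[D]_z `|(phi (y, z))%:E|
      <= \int[D]_z (K1%:E + K2%:E * (enorm (noise y.1 z) ^+ 2)%:E))%E.
    apply: ge0_le_integral => //.
    - by apply: measurableT_comp => //; apply/measurable_EFinP;
        exact: (measurableT_comp mphi (measurable_pair1 y)).
    - apply: emeasurable_funD => //; apply: emeasurable_funM => //.
      by apply/measurable_EFinP; exact: measurable_enorm_sqr.
    - by move=> z _; rewrite -EFinM -EFinD lee_fin; exact: phi_le.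
  apply: (le_trans h); rewrite ge0_integralD//; last 2 first.
  - by move=> z _; rewrite -EFinM lee_fin mulr_ge0// sqr_ge0.
  - apply: emeasurable_funM => //.
    by apply/measurable_EFinP; exact: measurable_enorm_sqr.
  rewrite integral_cst//= probability_setT mule1 integralZl//.
  rewrite (EFinD K1) (EFinM K2); apply: leeD => //.
  by apply: lee_wpmul2l; [rewrite lee_fin|exact: noise_variance].
have : (\int[nu]_y \int[D]_z `|(phi (y, z))%:E| <=
    \int[nu]_y (cst (K1 + K2 * tau ^+ 2)%:E y))%E.
  apply: ge0_le_integral => //.
  - by move=> y _; exact: integral_ge0.
  - apply: (@measurable_fun_fubini_tonelli_F _ _ _ _ _ D (fun p => `|(phi p)%:E|%E)) => //.
    by apply: measurableT_comp => //; exact/measurable_EFinP.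
move=> h; apply: (le_lt_trans h).
by rewrite integral_cst//= probability_setT mule1 ltry.
Qed.

End Oracle.

(** * Expectation bound *)

Lemma integral_le0 {R : realType} {dT} (T : measurableType dT)
    (mu : {measure set T -> \bar R}) (h : T -> \bar R) :
  (forall y, h y <= 0)%E -> (\int[mu]_y h y <= 0)%E.
Proof.
move=> h0; rewrite integralE.
rewrite [X in (X - _ <= _)%E]integral0_eq ?sub0e ?oppe_le0 ?integral_ge0//.
by move=> y _; rewrite funeposE; apply/max_idPr.
Qed.

Section Expectation.
Context {R : realType} {d : nat} {dX dO : measure_display}
  {Xi : measurableType dX} {Omega : measurableType dO}.
Variables (f : 'rV[R]_d -> R) (x0 xmin : 'rV[R]_d) (ell tau eta v0 Delta : R).
Variables (D : probability Xi R) (g : 'rV[R]_d -> Xi -> 'rV[R]_d).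
Variables (P : probability Omega R) (xi : nat -> Omega -> Xi).
Variable x : nat -> Omega -> 'rV[R]_d.
Hypotheses (ell0 : 0 < ell) (fs : smooth ell f) (tau0 : 0 < tau).
Hypothesis oracle : stochastic_gradient D tau f g.
Hypotheses (fmin : forall y, f xmin <= f y) (fD : f x0 - f xmin <= Delta).
Hypotheses (iid : iid_samples P D xi) (eta0 : 0 < eta) (v00 : 0 < v0).
Hypothesis run : adagrad_norm g xi x0 eta v0 x.

(** The chain lives on tuples, which carry the product sigma-algebra; [row] and [tup] translate to
    row vectors and back. *)
Let row (y : d.-tuple R) : 'rV[R]_d := \row_i tnth y i.
Let tup (v : 'rV[R]_d) : d.-tuple R := [tuple v 0 i | i < d].

Let rowK v : row (tup v) = v.
Proof. by apply/rowP => i; rewrite mxE tnth_mktuple. Qed.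

Let gs w t := g (x t w) (xi t w).
Let acc w t := v0 ^+ 2 + \sum_(k < t) enorm (gs w k) ^+ 2.

Let Y := (d.-tuple R * R)%type.
Let den (p : Y * Xi) := Num.sqrt (p.1.2 ^+ 2 + enorm (g (row p.1.1) p.2) ^+ 2).

(* (iterate, square root of the accumulated squared norms) is a Markov chain *)
Let F (p : Y * Xi) : Y :=
  (tup (row p.1.1 - (eta / den p) *: g (row p.1.1) p.2), den p).
Let X t (w : Omega) : Y := (tup (x t w), Num.sqrt (acc w t)).

Let acc_ge0 w t : 0 <= acc w t.
Proof. by rewrite addr_ge0 ?sqr_ge0// sumr_ge0// => k _; exact: sqr_ge0. Qed.

Let X0 w : X 0 w = (tup x0, v0).
Proof.
by rewrite /X (run w).1 /acc big_ord0 addr0 sqrtr_sqr gtr0_norm.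
Qed.

Let XS t w : X t.+1 w = F (X t w, xi t w).
Proof.
have denE : den (X t w, xi t w) = Num.sqrt (acc w t.+1).
  by rewrite /den/= rowK sqr_sqrtr// /acc big_ord_recr/= addrA.
by rewrite /F denE/= rowK /X (run w).2.
Qed.

Lemma measurable_sqrt {dY} (Z : measurableType dY) (h : Z -> R) :
  measurable_fun setT h -> measurable_fun setT (fun z => Num.sqrt (h z)).
Proof.
move=> mh; apply: (measurableT_comp _ mh).
exact: continuous_measurable_fun (@sqrt_continuous R).
Qed.

(** On nonnegative reals the inverse is the real power of exponent -1. *)
Lemma measurable_inv_ge0 {dY} (Z : measurableType dY) (h : Z -> R) :
  (forall z, 0 <= h z) -> measurable_fun setT h ->
  measurable_fun setT (fun z => (h z)^-1).
Proof.
move=> h0 mh; under eq_fun do rewrite -powR_inv1//.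
exact: (measurableT_comp (measurable_powR _) mh).
Qed.

Let mg := measurable_gradient_sample oracle.

Let mden : measurable_fun setT den.
Proof.
apply: measurable_sqrt; apply: measurable_funD.
  by apply: measurable_funX; exact: (measurableT_comp measurable_snd measurable_fst).
exact: measurable_enorm_sqr.
Qed.

Let mF : measurable_fun setT F.
Proof.
apply: measurable_fun_pair => //; apply/measurable_fun_tnthP => j.
rewrite (_ : _ \o _ = fun p => tnth p.1.1 j - eta * (den p)^-1 * g (row p.1.1) p.2 0 j).
  apply: measurable_funB.
    apply: (measurableT_comp (measurable_tnth j)).
    exact: (measurableT_comp measurable_fst measurable_fst).
  apply: measurable_funM => //; apply: measurable_funM => //.
  by apply: measurable_inv_ge0 => // p; exact: sqrtr_ge0.
by apply/funext => p /=; rewrite tnth_mktuple !mxE.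
Qed.

Let mgrad j : measurable_fun setT (fun y : Y => grad f (row y.1) 0 j).
Proof. exact: (measurableT_comp (measurable_grad oracle j) measurable_fst). Qed.

Let mX t : measurable_fun setT (X t).
Proof. exact: (measurable_chain iid mF X0 XS). Qed.

Lemma measurable_grad_path t : measurable_fun setT (fun w => enorm (grad f (x t w)) ^+ 2).
Proof.
rewrite (_ : (fun w => _) = (fun y : Y => enorm (grad f (row y.1)) ^+ 2) \o X t).
  by apply: measurableT_comp => //; exact: measurable_enorm_sqr.
by apply/funext => w /=; rewrite rowK.
Qed.

(** Integrates [adagrad_path_bound]: its random summands are drifts of the chain, of nonpositive
    mean. *)
Lemma expectation_sqrt_sum_grad (T : nat) (Gam M c m : R) :
  0 < M -> 2 <= c ->
  (forall t w, (t < T)%N -> enorm (grad f (x t w)) <= Gam) ->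
  v0 ^+ 2 + 2 * T%:R * Gam ^+ 2 + 2 * T%:R * tau ^+ 2 <= v0 ^+ 2 * M ->
  0 < m -> m ^+ 2 = 2 * T%:R * tau ^+ 2 ->
  (\int[P]_w (Num.sqrt (\sum_(t < T) enorm (grad f (x t w)) ^+ 2))%:E <=
   (c * (2 * (Delta / eta + (2 * tau + ell * eta) * ln M))
     + (v0 + tau + m) / c)%:E)%E.
Proof.
move=> M0 c2 GGam hM m0 m2.
have c0 : 0 < c by apply: lt_le_trans c2.
(* The coefficients of the noise excess that do not vary along the path. *)
pose A0 := 4 * c * (2 * tau + ell * eta) / (v0 ^+ 2 * M) + (m * c)^-1.
have A00 : 0 <= A0.
  have K0 : 0 < 2 * tau + ell * eta by rewrite addr_gt0// mulr_gt0.
  have v2M : 0 < v0 ^+ 2 * M by rewrite mulr_gt0// exprn_gt0.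
  by rewrite ltW// addr_gt0// ?divr_gt0 ?invr_gt0 ?mulr_gt0.
pose wt (y : Y) := Num.sqrt (y.2 ^+ 2 + enorm (grad f (row y.1)) ^+ 2 + tau ^+ 2).
have tau_wt y : tau <= wt y.
  rewrite -[leLHS]gtr0_norm// -sqrtr_sqr ler_wsqrtr//.
  by rewrite lerDr addr_ge0 ?sqr_ge0.
have wt0 y : 0 < wt y by apply: lt_le_trans (tau_wt y).
have G_wt y : enorm (grad f (row y.1)) <= wt y.
  rewrite -[leLHS]ger0_norm ?enorm_ge0// -sqrtr_sqr ler_wsqrtr//.
  by rewrite -addrA addrCA lerDl addr_ge0 ?sqr_ge0.
(* The truncation at [Gam], inactive along the path, makes [a] bounded. *)
pose a (y : Y) := 2 * c *
  (Num.min (enorm (grad f (row y.1)) ^+ 2) (Gam ^+ 2) / (4 * tau ^+ 2 * wt y)) + A0.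
pose H (y : Y) := (2 * c / wt y) *: grad f (row y.1).
have mwt : measurable_fun setT wt.
  apply: measurable_sqrt; apply: measurable_funD => //; apply: measurable_funD.
    by apply: measurable_funX; exact: measurable_snd.
  exact: measurable_enorm_sqr.
have den0 y : 0 <= 4 * tau ^+ 2 * wt y by rewrite mulr_ge0 ?(ltW (wt0 y))// mulr_ge0 ?sqr_ge0.
have ma : measurable_fun setT a.
  apply: measurable_funD => //; apply: measurable_funM => //; apply: measurable_funM.
    by apply: measurable_minr => //; exact: measurable_enorm_sqr.
  by apply: measurable_inv_ge0 => //; exact: measurable_funM.
have a0 y : 0 <= a y.
  apply: addr_ge0 => //. apply: mulr_ge0; first by rewrite mulr_ge0// ltW.
  by rewrite divr_ge0// le_min !sqr_ge0.
(* The truncated numerator is at most [Gam ^+ 2], and [wt] is at least [tau]. *)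
pose Ka := 2 * c * (Gam ^+ 2 / (4 * tau ^+ 2 * tau)) + A0.
have aK y : a y <= Ka.
  rewrite lerD2r ler_wpM2l ?mulr_ge0 ?(ltW c0)//.
  apply: ler_pM; rewrite ?le_min ?sqr_ge0 ?invr_ge0// ?ge_min ?lexx ?orbT//.
  rewrite lef_pV2 ?posrE ?mulr_gt0 ?exprn_gt0//.
  by rewrite ler_wpM2l// mulr_ge0 ?sqr_ge0.
have mH j : measurable_fun setT (fun y => H y 0 j).
  under eq_fun do rewrite mxE.
  apply: measurable_funM => //; apply: measurable_funM => //.
  by apply: measurable_inv_ge0 => // y; exact: ltW.
have HK y : enorm (H y) <= 2 * c.
  rewrite enormZ ger0_norm ?divr_ge0 ?mulr_ge0 ?(ltW c0) ?(ltW (wt0 y))//.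
  rewrite mulrAC ler_pdivrMr// ler_wpM2l// mulr_ge0// ltW//.
pose phi (p : Y * Xi) : R :=
  a p.1 * (enorm (g (row p.1.1) p.2 - grad f (row p.1.1)) ^+ 2 - tau ^+ 2)
  - dot (H p.1) (g (row p.1.1) p.2 - grad f (row p.1.1)).
have drift t : P.-integrable setT (fun w => (phi (X t w, xi t w))%:E) /\
    (\int[P]_w (phi (X t w, xi t w))%:E <= 0)%E.
  have iphi nu := drift_integrable oracle ma a0 aK mH HK nu.
  have [int_phi ->] := @chain_expectation _ _ _ _ _ _ _ P D xi _ F X iid mF X0 XS t phi
    (measurable_drift oracle ma mH) (iphi _).
  split => //; apply: integral_le0 => y.
  exact: (drift_mean_le0 oracle H a0).
pose B := c * (2 * (Delta / eta + (2 * tau + ell * eta) * ln M)) + (v0 + tau + m) / c.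
have path w : Num.sqrt (\sum_(t < T) enorm (grad f (x t w)) ^+ 2) <=
    B + \sum_(t < T) phi (X t w, xi t w).
  have [run0 runS] := run w.
  have := @adagrad_path_bound R d f xmin ell eta v0 tau (x ^~ w) (gs w)
    ell0 fs fmin eta0 v00 tau0 runS T Gam M Delta c m.
  rewrite run0 => /(_ fD M0 c2 (fun t => GGam t w) hM m0 m2) h.
  apply: (le_trans h); rewrite lerD2l; apply: ler_sum => t _.
  rewrite /phi /a /H /wt /= rowK (sqr_sqrtr (acc_ge0 w t)) -/(acc w t) -/(gs w t).
  rewrite min_l; last first.
        by rewrite lerXn2r ?nnegrE ?enorm_ge0 ?GGam// (le_trans (enorm_ge0 (grad f (x t w)))) ?GGam.
  rewrite [dot (_ *: _) _]dotC dotZr dotC /A0 !addrA.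
  rewrite le_eqVlt; apply/orP; left; apply/eqP.
  by congr (_ - _); ring.
have isum : P.-integrable setT (fun w => (B + \sum_(t < T) phi (X t w, xi t w))%:E).
  under eq_fun do rewrite EFinD -sumEFin.
  apply: integrableD => //; first exact: finite_measure_integrable_cst.
  by apply: integrable_sum => // t _; have [] := drift t.
have h : (\int[P]_w (Num.sqrt (\sum_(t < T) enorm (grad f (x t w)) ^+ 2))%:E <=
    \int[P]_w (B + \sum_(t < T) phi (X t w, xi t w))%:E)%E.
  apply: ge0_le_integral => //.
  - apply/measurable_EFinP; apply: measurable_sqrt; apply: measurable_sum => t.
    exact: measurable_grad_path.
  - by case/integrableP : isum.
  - by move=> w _; rewrite lee_fin.
apply: (le_trans h); under eq_integral do rewrite EFinD -sumEFin.
rewrite integralD//=; last 2 first.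
- exact: finite_measure_integrable_cst.
- by apply: integrable_sum => // t _; have [] := drift t.
rewrite integral_cst//= probability_setT mule1 integral_sum//; last first.
  by move=> t; have [] := drift t.
rewrite geeDl//; apply: sume_le0 => t _; exact: (drift t).2.
Qed.

End Expectation.

(** * Numerical bounds and rate *)

Section Numerics.
Context {R : realType}.

(** Compares monomials in [T], [ell], [Delta], [sigma] and [eta] factor by factor; an absent
    parameter appears as a factor 1. *)
Lemma ler_prod5 (x1 x2 x3 x4 x5 y1 y2 y3 y4 y5 : R) :
  0 <= x1 <= y1 -> 0 <= x2 <= y2 -> 0 <= x3 <= y3 -> 0 <= x4 <= y4 ->
  0 <= x5 <= y5 -> x1 * x2 * x3 * x4 * x5 <= y1 * y2 * y3 * y4 * y5.
Proof.
by do 5 move=> /andP[? ?]; do 4 (apply: ler_pM; rewrite ?mulr_ge0//).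
Qed.

(** Cauchy-Schwarz against the all-ones vector. *)
Lemma sum_le_sqrt (T : nat) (p : nat -> R) :
  \sum_(t < T) p t <= Num.sqrt T%:R * Num.sqrt (\sum_(t < T) p t ^+ 2).
Proof.
pose u : 'rV[R]_T := const_mx 1; pose v : 'rV[R]_T := \row_(t < T) p t.
have -> : \sum_(t < T) p t = dot u v.
  by apply: eq_bigr => t _; rewrite !mxE mul1r.
have -> : Num.sqrt T%:R = enorm u.
  rewrite /enorm; congr Num.sqrt; under eq_bigr do rewrite mxE expr1n.
  by rewrite sumr_const card_ord.
have -> : \sum_(t < T) p t ^+ 2 = \sum_(t < T) v 0 t ^+ 2.
  by apply: eq_bigr => t _; rewrite mxE.
exact: le_dot_enorm.
Qed.

Variables (T : nat) (ell Delta sigma eta v0 : R).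
Hypotheses (T0 : (0 < T)%N) (ell0 : 0 < ell) (Delta0 : 0 <= Delta).
Hypotheses (sigma0 : 0 <= sigma) (eta0 : 0 < eta) (v00 : 0 < v0).

Let L := log_factor T ell Delta sigma eta v0.
Let tau := sigma + ell * eta / T%:R.
Let B := Delta / eta + sigma + ell * eta.

Let T1 : 1 <= T%:R :> R. Proof. by rewrite ler1n. Qed.

Lemma log_factor_ge1 : 1 <= L.
Proof.
rewrite /L /log_factor.
have := ln_ge0 T1.
have : 0 <= ln (1 + ell) by rewrite ln_ge0// lerDl ltW.
have : 0 <= ln (1 + Delta) by rewrite ln_ge0// lerDl.
have : 0 <= ln (1 + sigma) by rewrite ln_ge0// lerDl.
have := normr_ge0 (ln eta); have := normr_ge0 (ln v0); lra.
Qed.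

Lemma rate_scale_ge0 : 0 <= B.
Proof. by rewrite !addr_ge0 ?divr_ge0 ?mulr_ge0// ltW. Qed.

Lemma tau_gt0 : 0 < tau.
Proof. by rewrite ltr_wpDl// divr_gt0 ?mulr_gt0// ltr0n. Qed.

Lemma tau_le : tau <= sigma + ell * eta.
Proof.
by rewrite lerD2l ler_pdivrMr ?ltr0n// ler_peMr// mulr_ge0 ?ltW.
Qed.

(* The accumulated squared norms have a mean polynomial in the parameters, so
   their logarithm is at most a multiple of the logarithmic factor. *)
Lemma moment_le_expR :
  v0 ^+ 2 + 2 * T%:R * (Num.sqrt (4 * ell * Delta) + ell * eta * T%:R) ^+ 2
    + 2 * T%:R * tau ^+ 2 <= v0 ^+ 2 * expR (28 * L).
Proof.
set Gam := Num.sqrt _ + _.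
pose a := 1 + ell; pose b := 1 + Delta; pose s := 1 + sigma.
pose p := expR `|ln eta|; pose q := expR `|ln v0|.
have a1 : 1 <= a by rewrite lerDl ltW.
have b1 : 1 <= b by rewrite lerDl.
have s1 : 1 <= s by rewrite lerDl.
have p1 : 1 <= p by rewrite -expR0 ler_expR.
have q1 : 1 <= q by rewrite -expR0 ler_expR.
have etap : eta <= p by rewrite -[leLHS]lnK ?posrE// ler_expR ler_norm.
have v0q : 1 <= v0 * q.
  by rewrite -[X in X * _]lnK ?posrE// -expRD -expR0 ler_expR -lerBlDl sub0r -normrN ler_norm.
(* Apart from [v0 ^+ 2], all terms to be bounded are monomials dominated by [U]; the factor [q] will
   compensate a small [v0]. *)
pose U := T%:R ^+ 3 * a ^+ 2 * b * s ^+ 2 * p ^+ 2.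
have sq1 (y : R) : 1 <= y -> 1 <= y ^+ 2 by move=> y1; exact: exprn_ege1.
have T3 : 1 <= T%:R ^+ 3 :> R by exact: exprn_ege1.
have TT3 : 0 <= (T%:R : R) <= T%:R ^+ 3 by rewrite ler0n ler_eXnr.
have le01 (y : R) : 1 <= y -> 0 <= (1 : R) <= y by rewrite ler01.
have l2a2 : 0 <= ell ^+ 2 <= a ^+ 2.
  by rewrite sqr_ge0 lerXn2r ?nnegrE ?addr_ge0 ?(ltW ell0)// lerDr.
have la2 : 0 <= ell <= a ^+ 2.
  rewrite (ltW ell0)/= (le_trans (_ : ell <= a))// ?lerDr// ler_eXnr//.
have Db : 0 <= Delta <= b by rewrite Delta0 lerDr ler01.
have ss : 0 <= sigma ^+ 2 <= s ^+ 2.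
  by rewrite sqr_ge0 lerXn2r ?nnegrE ?addr_ge0// lerDr.
have pp : 0 <= eta ^+ 2 <= p ^+ 2.
  by rewrite sqr_ge0 lerXn2r ?nnegrE ?(ltW eta0)// (le_trans (ltW eta0)).
have b01 := le01 _ b1; have s01 := le01 _ (sq1 _ s1); have p01 := le01 _ (sq1 _ p1).
have a01 := le01 _ (sq1 _ a1); have T01 := le01 _ T3.
have k0 := ler_prod5 T01 a01 b01 s01 p01.
have k1 := ler_prod5 TT3 la2 Db s01 p01.
have TT : 0 <= (T%:R ^+ 3 : R) <= T%:R ^+ 3 by rewrite lexx andbT (le_trans _ T3).
have k2 := ler_prod5 TT l2a2 b01 s01 pp.
have k3 := ler_prod5 TT3 a01 b01 ss p01.
have k4 := ler_prod5 TT3 l2a2 b01 s01 pp.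
rewrite -/U in k0 k1 k2 k3 k4.
have Gam2 : Gam ^+ 2 <= 8 * ell * Delta + 2 * (ell * eta * T%:R) ^+ 2.
  have e : Num.sqrt (4 * ell * Delta) ^+ 2 = 4 * ell * Delta.
    by rewrite sqr_sqrtr// !mulr_ge0// ltW.
  have := sqr_ge0 (Num.sqrt (4 * ell * Delta) - ell * eta * T%:R).
  by rewrite /Gam; move: e; lra.
have tau2 : tau ^+ 2 <= 2 * sigma ^+ 2 + 2 * (ell ^+ 2 * eta ^+ 2).
  have : tau ^+ 2 <= (sigma + ell * eta) ^+ 2.
    by rewrite lerXn2r ?nnegrE ?(ltW tau_gt0) ?tau_le// addr_ge0// mulr_ge0 ?ltW.
  by have := sqr_ge0 (sigma - ell * eta); rewrite -exprMn; lra.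
have vq2 : 1 <= v0 ^+ 2 * q ^+ 2 by rewrite -exprMn sq1.
have U1 : 1 <= U by apply: le_trans k0; rewrite !mulr1.
(* 28 = 16 + 4 + 4 + 4, the coefficients of the four monomials bounded in [k1] to [k4]. *)
have h1 : 2 * T%:R * Gam ^+ 2 + 2 * T%:R * tau ^+ 2 <= 28 * U.
  have T2 : 0 <= 2 * T%:R :> R by rewrite mulr_ge0.
  have := ler_wpM2l T2 Gam2; have := ler_wpM2l T2 tau2.
  have -> : 2 * T%:R * (8 * ell * Delta + 2 * (ell * eta * T%:R) ^+ 2) =
    16 * (T%:R * ell * Delta * 1 * 1) + 4 * (T%:R ^+ 3 * ell ^+ 2 * 1 * 1 * eta ^+ 2).
    by ring.
  have -> : 2 * T%:R * (2 * sigma ^+ 2 + 2 * (ell ^+ 2 * eta ^+ 2)) =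
    4 * (T%:R * 1 * 1 * sigma ^+ 2 * 1) + 4 * (T%:R * ell ^+ 2 * 1 * 1 * eta ^+ 2).
    by ring.
  lra.
have h2 : v0 ^+ 2 + 28 * U <= v0 ^+ 2 * (29 * (q ^+ 2 * U)).
  have e1 : v0 ^+ 2 <= v0 ^+ 2 * (q ^+ 2 * U).
    rewrite ler_peMr ?sqr_ge0// -[1]mulr1 ler_pM// sq1//.
  have e2 : U <= v0 ^+ 2 * q ^+ 2 * U by rewrite ler_peMl// (le_trans _ U1).
  lra.
have h3 : 29 * (q ^+ 2 * U) <= expR (28 * L).
  have L1 := log_factor_ge1.
  have elnK (y : R) : 1 <= y -> expR (ln y) = y.
    by move=> y1; rewrite lnK// posrE (lt_le_trans _ y1).
  have lnU : q ^+ 2 * U = expR (2 * `|ln v0| + 3 * ln T%:R + 2 * ln (1 + ell)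
       + ln (1 + Delta) + 2 * ln (1 + sigma) + 2 * `|ln eta|).
    rewrite !expRD !expRM_natl !elnK// /U /a /b /s /p /q.
    by ring.
  (* The unit term of [L] pays for 29, as [1 + 28 <= expR 28]; the rest pays for the exponents,
     which are at most 3. *)
  have -> : 28 * L = 28 + 28 * (L - 1) by ring.
  rewrite expRD ler_pM//.
  - by rewrite mulr_ge0 ?sqr_ge0// (le_trans _ U1).
  - by have := @expR_ge1Dx R 28; lra.
  - rewrite lnU ler_expR /L /log_factor.
    have := ln_ge0 T1; have := ln_ge0 a1; have := ln_ge0 b1; have := ln_ge0 s1.
    rewrite /a /b /s.
    have := normr_ge0 (ln eta); have := normr_ge0 (ln v0); lra.
have := ler_wpM2l (sqr_ge0 v0) h3.
lra.
Qed.

(** [c] balances [c * a0] against [R0 / c], where [a0] dominates [A']; its summand 2 secures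
    [2 <= c]. Since [ell * eta <= a0], [a0] is positive even if [Delta] and [sigma] vanish. *)
Lemma rate_le (a0 A' m c : R) : a0 = 168 * L * B ->
  A' = 2 * (Delta / eta + (2 * tau + ell * eta) * (28 * L)) ->
  m = Num.sqrt (2 * T%:R) * tau -> c = 2 + Num.sqrt ((v0 + tau + m) / a0) ->
  (c * A' + (v0 + tau + m) / c) / Num.sqrt T%:R <=
    2 * (12 * a0) / Num.sqrt T%:R + Num.sqrt (v0 * (12 * a0)) / Num.sqrt T%:R
    + 2 * Num.sqrt (12 * a0 * sigma) / (T%:R `^ 4^-1).
Proof.
move=> a0E A'E mE cE.
have L1 := log_factor_ge1; have B0 := rate_scale_ge0.
have le0 : 0 < ell * eta by rewrite mulr_gt0.
have De0 : 0 <= Delta / eta by rewrite divr_ge0// ltW.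
have LB : B <= L * B by rewrite ler_peMl.
have a0le : ell * eta <= a0.
  have h : ell * eta <= B by rewrite lerDr addr_ge0.
  rewrite a0E -mulrA (le_trans h)// (le_trans LB)//.
  by rewrite ler_peMl ?mulr_ge0 ?ler1n// (le_trans _ L1).
have a00 : 0 < a0 by apply: lt_le_trans a0le.
(* 168 = 2 * 28 * 3, where 3 is the coefficient of [ell * eta] in the bound on
   [2 * tau + ell * eta]. *)
have A'a0 : A' <= a0.
  have h : 2 * tau + ell * eta <= 2 * sigma + 3 * (ell * eta) by have := tau_le; lra.
  have L28 : 0 <= 28 * L by rewrite mulr_ge0// (le_trans _ L1).
  have h1 := ler_wpM2r L28 h.
  have h2 : Delta / eta <= L * (Delta / eta) by rewrite ler_peMl.
  have h3 : 0 <= L * sigma by rewrite mulr_ge0// (le_trans _ L1).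
  have h4 : 0 <= L * (Delta / eta) by rewrite mulr_ge0// (le_trans _ L1).
  rewrite A'E a0E /B.
  have -> : 168 * L * (Delta / eta + sigma + ell * eta) =
    168 * (L * (Delta / eta)) + 168 * (L * sigma) + 168 * (L * (ell * eta)) by ring.
  have : (2 * sigma + 3 * (ell * eta)) * (28 * L) =
    56 * (L * sigma) + 84 * (L * (ell * eta)) by ring.
  lra.
set R0 := v0 + tau + m in cE *.
have sT : 1 <= Num.sqrt T%:R :> R by rewrite -[leLHS]sqrtr1 ler_wsqrtr.
have sT0 : 0 < Num.sqrt T%:R :> R by apply: lt_le_trans sT.
have sT2 : Num.sqrt T%:R ^+ 2 = T%:R :> R by rewrite sqr_sqrtr.
have t0 := tau_gt0.
have m0 : 0 < m by rewrite mE mulr_gt0// sqrtr_gt0 mulr_gt0// ltr0n.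
have R00 : 0 < R0 by rewrite addr_gt0// addr_gt0.
(* The part [ell * eta / T%:R] added to [sigma] costs at most [a0], because the square root of [T]
   is at most [T]. *)
have sTtau : Num.sqrt T%:R * tau <= Num.sqrt T%:R * sigma + a0.
  rewrite /tau mulrDr lerD2l (le_trans _ a0le)//.
  rewrite mulrCA ler_piMr ?(ltW le0)// ler_pdivrMr ?ltr0n// mul1r -[leRHS]sT2.
  by rewrite expr2 ler_peMl// ltW.
have R0le : R0 <= v0 + 3 * (Num.sqrt T%:R * sigma) + 3 * a0.
  have h1 : m <= 2 * (Num.sqrt T%:R * tau).
    rewrite mE sqrtrM// mulrA ler_wpM2r ?(ltW t0)// ler_wpM2r ?(ltW sT0)//.
    rewrite -[leRHS]ger0_norm// -sqrtr_sqr ler_wsqrtr//; lra.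
  have h2 : tau <= Num.sqrt T%:R * tau by rewrite ler_peMl// ltW.
  by rewrite /R0; lra.
(* The common size of the balanced terms: [c * a0] exceeds it by [2 * a0] and [R0 / c] stays below
   it. *)
pose z := Num.sqrt (R0 * a0).
have c0 : 0 < c by rewrite cE ltr_wpDr// sqrtr_ge0.
have sR : 0 < Num.sqrt (R0 / a0) by rewrite sqrtr_gt0 divr_gt0.
have ca0 : c * a0 = 2 * a0 + z.
  rewrite cE mulrDl; congr (_ + _); rewrite /z.
  have -> : R0 * a0 = R0 / a0 * a0 ^+ 2 by field; rewrite gt_eqF.
  by rewrite [in RHS]sqrtrM ?divr_ge0 ?ltW// sqrtr_sqr gtr0_norm.
have R0c : R0 / c <= z.
  rewrite ler_pdivrMr//.
  have -> : R0 = z * Num.sqrt (R0 / a0).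
    rewrite /z -sqrtrM ?mulr_ge0 ?ltW//.
    have -> : R0 * a0 * (R0 / a0) = R0 ^+ 2 by field; rewrite gt_eqF.
    by rewrite sqrtr_sqr gtr0_norm.
  by rewrite cE ler_wpM2l ?sqrtr_ge0// lerDr.
pose r : R := T%:R `^ 4^-1.
have rE : r = Num.sqrt (Num.sqrt T%:R).
  by rewrite -!powR12_sqrt ?powR_ge0// -powRrM /r; congr (_ `^ _); field.
have r0 : 0 < r by rewrite rE sqrtr_gt0.
have r2 : r ^+ 2 = Num.sqrt T%:R by rewrite rE sqr_sqrtr// ltW.
have zle : z <= Num.sqrt (v0 * a0) + 2 * r * Num.sqrt (a0 * sigma) + 2 * a0.
  have n1 : 0 <= v0 * a0 by rewrite mulr_ge0 ?ltW.
  have n2 : 0 <= 3 * (Num.sqrt T%:R * sigma) * a0.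
    by rewrite mulr_ge0 ?(ltW a00)// mulr_ge0// mulr_ge0// ltW.
  have n3 : 0 <= 3 * a0 * a0 by rewrite !mulr_ge0// ltW.
  have h : z <= Num.sqrt (v0 * a0 + 3 * (Num.sqrt T%:R * sigma) * a0 + 3 * a0 * a0).
    by rewrite ler_wsqrtr// -!mulrDl ler_wpM2r// ltW.
  have e1 := sqrtrD_le (addr_ge0 n1 n2) n3.
  have e2 := sqrtrD_le n1 n2.
  have e3 : Num.sqrt (3 * a0 * a0) <= 2 * a0.
    rewrite -[leRHS]ger0_norm ?mulr_ge0 ?(ltW a00)// -sqrtr_sqr ler_wsqrtr//.
    by have := sqr_ge0 a0; lra.
  have e4 : Num.sqrt (3 * (Num.sqrt T%:R * sigma) * a0) <= 2 * r * Num.sqrt (a0 * sigma).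
    have -> : 2 * r * Num.sqrt (a0 * sigma) = Num.sqrt ((2 * r) ^+ 2 * (a0 * sigma)).
      by rewrite [in RHS]sqrtrM ?sqr_ge0// sqrtr_sqr ger0_norm// mulr_ge0// ltW.
    rewrite ler_wsqrtr// exprMn r2.
    have : 0 <= Num.sqrt T%:R * sigma * a0 by rewrite !mulr_ge0// ltW.
    lra.
  lra.
(* The term [z] occurs twice; since [4 <= 12], this factor 2 fits under the square roots, here and
   in [k2]. *)
have k1 : 2 * Num.sqrt (v0 * a0) <= Num.sqrt (v0 * (12 * a0)).
  rewrite -[X in X * _](ger0_norm (ler0n R 2)) -sqrtr_sqr -sqrtrM ?sqr_ge0//.
  rewrite ler_wsqrtr//; have : 0 <= v0 * a0 by rewrite mulr_ge0 ?ltW.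
  lra.
have k2 : 2 * Num.sqrt (a0 * sigma) <= Num.sqrt (12 * a0 * sigma).
  rewrite -[X in X * _](ger0_norm (ler0n R 2)) -sqrtr_sqr -sqrtrM ?sqr_ge0//.
  rewrite ler_wsqrtr//; have : 0 <= a0 * sigma by rewrite mulr_ge0// ltW.
  lra.
have tot : c * A' + R0 / c <= 24 * a0 + Num.sqrt (v0 * (12 * a0))
    + 2 * Num.sqrt (12 * a0 * sigma) * r.
  have := ler_wpM2l (ltW c0) A'a0.
  have := ler_wpM2r (ltW r0) k2.
  lra.
rewrite -/r.
have -> : 2 * Num.sqrt (12 * a0 * sigma) / r =
    2 * Num.sqrt (12 * a0 * sigma) * r / Num.sqrt T%:R.
  by rewrite -r2; field; rewrite gt_eqF.
rewrite -!mulrDl ler_pM2r ?invr_gt0//.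
by apply: (le_trans tot); lra.
Qed.

End Numerics.

(** * Assembly of the convergence rate *)

Lemma stochastic_gradient_le {R : realType} {d : nat} {dX : measure_display}
    {Xi : measurableType dX} (D : probability Xi R) (sigma tau : R)
    (f : 'rV[R]_d -> R) (g : 'rV[R]_d -> Xi -> 'rV[R]_d) :
  0 <= sigma <= tau -> stochastic_gradient D sigma f g ->
  stochastic_gradient D tau f g.
Proof.
move=> /andP[s0 st] [mg ig eg vg]; split => // y.
by rewrite (le_trans (vg y))// lee_fin lerXn2r ?nnegrE// (le_trans s0).
Qed.

Theorem proposition3 (R : realType) :
  exists A : quantity R,
    tildeO A (fun T ell Delta sigma eta v0 => Delta / eta + sigma + ell * eta) /\
    forall (d : nat) (f : 'rV[R]_d -> R) (x0 xmin : 'rV[R]_d)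
      (ell Delta sigma : R)
      (dX : measure_display) (Xi : measurableType dX) (D : probability Xi R)
      (g : 'rV[R]_d -> Xi -> 'rV[R]_d)
      (dO : measure_display) (Omega : measurableType dO)
      (P : probability Omega R) (xi : nat -> Omega -> Xi)
      (eta v0 : R) (x : nat -> Omega -> 'rV[R]_d) (T : nat),
    0 < ell -> smooth ell f ->
    0 <= sigma -> stochastic_gradient D sigma f g ->
    (forall y, f xmin <= f y) -> f x0 - f xmin <= Delta ->
    iid_samples P D xi ->
    0 < eta -> 0 < v0 -> adagrad_norm g xi x0 eta v0 x ->
    (0 < T)%N ->
    let a := A T ell Delta sigma eta v0 in
    ((T%:R^-1)%:E * (\sum_(t < T) 'E_P[fun w => enorm (grad f (x t w))])
     <= (2 * a / Num.sqrt T%:R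
         + Num.sqrt (v0 * a) / Num.sqrt T%:R
         + 2 * Num.sqrt (a * sigma) / (T%:R `^ 4^-1))%:E)%E.
Proof.
(* 168 and 12 are the constants of [rate_le]. *)
exists (fun T ell Delta sigma eta v0 => 12 * (168 *
  log_factor T ell Delta sigma eta v0 * (Delta / eta + sigma + ell * eta))).
split.
  exists (12 * 168) => T ell Delta sigma eta v0 T0 l0 D0 s0 e0 v00.
  have L1 := log_factor_ge1 eta v0 T0 l0 D0 s0.
  have B0 := rate_scale_ge0 l0 D0 s0 e0.
  by rewrite ger0_norm ?mulrA// !mulr_ge0// (le_trans _ L1).
move=> d f x0 xmin ell Delta sigma dX Xi D g dO Omega P xi eta v0 x T.
move=> ell0 fs sigma0 oracle fmin fD iid eta0 v00 run T0; cbv zeta.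
have Delta0 : 0 <= Delta by rewrite (le_trans _ fD)// subr_ge0.
pose L := log_factor T ell Delta sigma eta v0.
pose tau := sigma + ell * eta / T%:R.
pose m := Num.sqrt (2 * T%:R) * tau.
pose a0 := 168 * L * (Delta / eta + sigma + ell * eta).
pose c := 2 + Num.sqrt ((v0 + tau + m) / a0).
pose Gam := Num.sqrt (4 * ell * Delta) + ell * eta * T%:R.
have tau0 : 0 < tau := tau_gt0 T0 ell0 sigma0 eta0.
have T0R : 0 < T%:R :> R by rewrite ltr0n.
have oracle' : stochastic_gradient D tau f g.
  apply: stochastic_gradient_le oracle; rewrite sigma0 lerDl.
  by rewrite divr_ge0// mulr_ge0 ?ltW.
(* [enorm_grad_sqr_le] bounds the initial gradient, and each step adds at most [ell * eta]. *)
have GGam t w : (t < T)%N -> enorm (grad f (x t w)) <= Gam.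
  move=> tT; have [run0 runS] := run w.
  have := @enorm_grad_path R d f ell eta v0 (x ^~ w) _ ell0 fs eta0 v00 runS t.
  rewrite run0 => h; apply: (le_trans h); apply: lerD; last first.
    by rewrite ler_wpM2l ?ler_nat 1?ltnW// mulr_ge0// ltW.
  rewrite -[leLHS]ger0_norm ?enorm_ge0// -sqrtr_sqr ler_wsqrtr//.
  rewrite (le_trans (enorm_grad_sqr_le ell0 fs x0 fmin))//.
  by rewrite ler_wpM2l// mulr_ge0// ltW.
have m0 : 0 < m by rewrite mulr_gt0// sqrtr_gt0 mulr_gt0.
have m2 : m ^+ 2 = 2 * T%:R * tau ^+ 2 by rewrite exprMn sqr_sqrtr// mulr_ge0.
have c2 : 2 <= c by rewrite lerDl sqrtr_ge0.
(* With [M = expR (28 * L)], the logarithm in the bound is [28 * L]. *)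
have core := expectation_sqrt_sum_grad ell0 fs tau0 oracle' fmin fD iid eta0 v00 run
  (expR_gt0 (28 * L)) c2 GGam
  (moment_le_expR T0 ell0 Delta0 sigma0 eta0 v00) m0 m2.
rewrite expRK in core.
have rate := rate_le T0 ell0 Delta0 sigma0 eta0 v00 (erefl a0) (erefl _)
  (erefl m) (erefl c).
rewrite -lee_fin in rate; apply: (le_trans _ rate).
have mG t : measurable_fun setT (fun w => enorm (grad f (x t w))).
  rewrite (_ : (fun w => _) = fun w => Num.sqrt (enorm (grad f (x t w)) ^+ 2)).
    apply: measurable_sqrt.
    exact: (measurable_grad_path oracle' iid v00 run).
  by apply/funext => w; rewrite sqrtr_sqr ger0_norm ?enorm_ge0.
have sumE : (\sum_(t < T) 'E_P[fun w => enorm (grad f (x t w))] =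
    \int[P]_w (\sum_(t < T) enorm (grad f (x t w)))%:E)%E.
  under [RHS]eq_integral do rewrite -sumEFin.
  rewrite ge0_integral_sum//.
  - by apply: eq_bigr => t _; rewrite unlock.
  - by move=> t; exact/measurable_EFinP.
  - by move=> t w _; rewrite lee_fin enorm_ge0.
pose S w := Num.sqrt (\sum_(t < T) enorm (grad f (x t w)) ^+ 2).
have mS : measurable_fun setT (fun w => (S w)%:E).
  apply/measurable_EFinP/measurable_sqrt/measurable_sum => t.
  exact: (measurable_grad_path oracle' iid v00 run).
(* Cauchy-Schwarz on each path turns the sum of norms into the root of the sum of squares that
   [core] controls. *)
have sum_le : (\sum_(t < T) 'E_P[fun w => enorm (grad f (x t w))] <=
    (Num.sqrt T%:R)%:E * \int[P]_w (S w)%:E)%E.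
  rewrite sumE -ge0_integralZl//; last by move=> w _; rewrite lee_fin sqrtr_ge0.
  apply: ge0_le_integral => //.
  - by move=> w _; rewrite lee_fin sumr_ge0// => t _; exact: enorm_ge0.
  - by apply/measurable_EFinP; apply: measurable_sum.
  - exact: emeasurable_funM.
  - move=> w _; rewrite -EFinM lee_fin.
    exact: (sum_le_sqrt T (fun t => enorm (grad f (x t w)))).
have sT0 : 0 < Num.sqrt T%:R :> R by rewrite sqrtr_gt0.
have Ti0 : (0 <= (T%:R^-1)%:E :> \bar R)%E by rewrite lee_fin invr_ge0.
apply: (le_trans (lee_wpmul2l Ti0 sum_le)).
have sTe0 : (0 <= (Num.sqrt T%:R)%:E :> \bar R)%E by rewrite lee_fin ltW.
apply: (le_trans (lee_wpmul2l Ti0 (lee_wpmul2l sTe0 core))).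
rewrite -!EFinM lee_fin mulrA.
have -> : T%:R^-1 * Num.sqrt T%:R = (Num.sqrt T%:R)^-1 :> R.
  by rewrite -[in T%:R^-1](sqr_sqrtr (ler0n R T)); field; rewrite gt_eqF.
by rewrite mulrC.
Qed.
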